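(* In the Kleisli category $\mathcal{K}\ell(\mathcal{G})$ of the Giry monad, consider the chain of draw-and-delete channels $$\mathcal{M}[0](2) \xleftarrow{\ \mathsf{DD}\ } \mathcal{M}[1](2) \xleftarrow{\ \mathsf{DD}\ } \mathcal{M}[2](2) \xleftarrow{\ \mathsf{DD}\ } \cdots \xleftarrow{\ \mathsf{DD}\ } \mathcal{M}[K](2) \xleftarrow{\ \mathsf{DD}\ } \mathcal{M}[K+1](2) \xleftarrow{\ \mathsf{DD}\ }\cdots$$ The unit interval $[0,1]\cong\mathcal{D}(2)$, together with the binomial channels $\mathrm{binom}[K]\colon [0,1] \to \mathcal{G}(\mathcal{M}[K](2))$ for $K\in\mathbb{N}$, is a limit of this chain in $\mathcal{K}\ell(\mathcal{G})$. Explicitly: the binomial channels form a cone, that is, $\mathsf{DD}\circ \mathrm{binom}[K+1] = \mathrm{binom}[K]$ (Kleisli composition) for every $K\in\mathbb{N}$; and for every measurable space $Y$ and every family of channels $c_K$ from $Y$ to $\mathcal{M}[K](2)\cong\{0,1,\ldots,K\}$ ($K\in\mathbb{N}$) with $\mathsf{DD}\circ c_{K+1}=c_K$ for all $K\in\mathbb{N}$, there is a unique channel $c$ from $Y$ to $[0,1]$ such that $\mathrm{binom}[K]\circ c = c_K$ for each $K\in\mathbb{N}$.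
   Context: Giry monad and channels. For a measurable space $X$, $\mathcal{G}(X)$ is the set of probability measures on $X$, with the least $\sigma$-algebra making the sets $\{\omega \mid \omega(U)<r\}$ measurable for all measurable $U\subseteq X$ and all real $r$. A channel from $X$ to $Y$ (a morphism of $\mathcal{K}\ell(\mathcal{G})$) is a measurable function $f\colon X\to\mathcal{G}(Y)$. Kleisli composition of a channel $f$ from $X$ to $Y$ and a channel $g$ from $Y$ to $Z$ is $(g\circ f)(x)(U)=\int_Y g(y)(U)\,f(x)(\mathrm{d}y)$. Finite sets carry the $\sigma$-algebra of all subsets, and $[0,1]$ carries the Borel $\sigma$-algebra. Multisets. Let $2=\{0,1\}$. $\mathcal{M}[K](2)$ is the finite set of functions $\varphi\colon 2\to\mathbb{N}$ with $\varphi(0)+\varphi(1)=K$ (multisets of size $K$ over $2$). It is identified with $\{0,1,\ldots,K\}$, where $k$ corresponds to the multiset containing $0$ with multiplicity $k$ and $1$ with multiplicity $K-k$. Distributions. $\mathcal{D}(2)$ is the set of probability distributions on $2$; it is identified with $[0,1]$, where $r\in[0,1]$ corresponds to the distribution giving probability $r$ to $0$ and $1-r$ to $1$. Formal convex sums $\sum_i r_i|x_i\rangle$ denote discrete probability distributions. Draw-and-delete. $\mathsf{DD}$ is the channel from $\mathcal{M}[K+1](2)$ to $\mathcal{M}[K](2)$ that removes a uniformly random element from the multiset: $\mathsf{DD}(\psi)=\sum_{x\in 2,\,\psi(x)>0}\frac{\psi(x)}{K+1}\,|\psi-1|x\rangle\rangle$, where $\psi-1|x\rangle$ is $\psi$ with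 the multiplicity of $x$ lowered by one. Under the identification above, for $\ell\in\{0,\ldots,K+1\}$, $\mathsf{DD}(\ell)=\frac{\ell}{K+1}|\ell-1\rangle+\frac{K+1-\ell}{K+1}|\ell\rangle$. Binomial channel. $\mathrm{binom}[K](r)=\sum_{0\le k\le K}\binom{K}{k}r^k(1-r)^{K-k}\,|k\rangle$ on $\{0,\ldots,K\}\cong\mathcal{M}[K](2)$, with $0^0=1$. *)

(* Defs.v *)
From HB Require Import structures.
From mathcomp Require Import all_boot all_order all_algebra.
From mathcomp Require Import all_classical all_reals all_analysis.
From mathcomp Require Import measurable_realfun.

Set Implicit Arguments.
Unset Strict Implicit.
Unset Printing Implicit Defensive.

Import Order.TTheory GRing.Theory Num.Theory.
Import numFieldNormedType.Exports.

Local Open Scope classical_set_scope.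
Local Open Scope ring_scope.

(* [pprobability Y R] is the set of probability measures on [Y] with the
   sigma-algebra generated by the sets [mset U r = [set mu | mu U < r]], with
   [U] measurable and [r] in [0, 1]; for other values of [r] these sets are
   empty or full, so this is the object part of the Giry monad. *)
Definition channel d d' (X : measurableType d) (Y : measurableType d')
    (R : realType) :=
  {mfun X >-> pprobability Y R}.

Definition channel_at d d' (X : measurableType d) (Y : measurableType d')
    (R : realType) (f : channel X Y R) (x : X) : probability Y R := f x.

(* A [probability Y R] is a function on all of [set Y] that is constrained only
   on measurable sets, so two of them are the same probability measure when
   they agree on the measurable sets; Leibniz equality would be too strong. *)
Definition channel_eq d d' (X : measurableType d) (Y : measurableType d')
    (R : realType) (f g : channel X Y R) : Prop :=
  forall x U, measurable U -> channel_at f x U = channel_at g x U.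

Lemma measurable_channel_at d d' (X : measurableType d) (Y : measurableType d')
    (R : realType) (f : channel X Y R) U : measurable U ->
  measurable_fun [set: X] ((channel_at f) ^~ U).
Proof.
move=> mU.
exact: (measurable_kernel (kprobability (measurable_funPT f)) U mU).
Qed.

Lemma measurable_pprobability d d' (X : measurableType d)
    (Y : measurableType d') (R : realType) (f : X -> probability Y R) :
  (forall U, measurable U -> measurable_fun [set: X] (f ^~ U)) ->
  measurable_fun [set: X] (f : X -> pprobability Y R).
Proof.
move=> mf.
apply: (measurability (@pset _ _ _ : set (set (pprobability Y R)))) => //.
move=> _ -[_ [r r01] [U mU <-]] <-.
by apply: emeasurable_fun_infty_o => //; exact: mf.
Qed.

Section kleisli_composition.
Context d0 d1 d2 (X : measurableType d0) (Y : measurableType d1)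
  (Z : measurableType d2) (R : realType).
Variables (g : channel Y Z R) (f : channel X Y R).
Local Open Scope ereal_scope.

Definition kleisli_measure (x : X) (U : set Z) : \bar R :=
  \int[channel_at f x]_y channel_at g y U.

Let kleisli_measure0 x : kleisli_measure x set0 = 0.
Proof. by apply: integral0_eq => y _; rewrite measure0. Qed.

Let kleisli_measure_ge0 x U : 0 <= kleisli_measure x U.
Proof. by apply: integral_ge0 => y _; exact: measure_ge0. Qed.

Let kleisli_measure_sigma_additive x : semi_sigma_additive (kleisli_measure x).
Proof.
exact: (@measure_semi_sigma_additive _ _ _
  (mkcomp_noparam (kprobability (measurable_funPT f))
                  (kprobability (measurable_funPT g)) x)).
Qed.

HB.instance Definition _ x := isMeasure.Build _ _ _ (kleisli_measure x)
  (kleisli_measure0 x) (kleisli_measure_ge0 x)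
  (@kleisli_measure_sigma_additive x).

Let kleisli_measure_setT x : kleisli_measure x setT = 1.
Proof.
rewrite /kleisli_measure.
transitivity (\int[channel_at f x]_(_ in [set: Y]) 1).
  by apply: eq_integral => y _; exact: probability_setT.
by rewrite integral_cst// mul1e; exact: probability_setT.
Qed.

HB.instance Definition _ x := Measure_isProbability.Build _ _ _
  (kleisli_measure x) (kleisli_measure_setT x).

Definition kleisli_fun (x : X) : pprobability Z R :=
  (kleisli_measure x : probability Z R).

Let measurable_kleisli_fun : measurable_fun [set: X] kleisli_fun.
Proof.
apply: measurable_pprobability => U mU.
exact: (measurable_kernel
  (mkcomp_noparam (kprobability (measurable_funPT f))
                  (kprobability (measurable_funPT g))) U mU).
Qed.

HB.instance Definition _ := isMeasurableFun.Build _ _ X (pprobability Z R)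
  kleisli_fun measurable_kleisli_fun.

Definition kleisli_comp : channel X Z R := kleisli_fun.

End kleisli_composition.

Section formal_convex_sum.
Context d (T : measurableType d) (R : realType) (I : finType).
Variables (w : I -> R) (x : I -> T).
Local Open Scope ereal_scope.

(* The discrete probability $\sum_i w_i |x_i\rangle$. *)
Definition convex_sum (w_ge0 : forall i, (0 <= w i)%R)
    (w_sum1 : (\sum_i w i = 1)%R) (U : set T) : \bar R :=
  \sum_i (w i)%:E * \d_(x i) U.

Hypotheses (w_ge0 : forall i, (0 <= w i)%R) (w_sum1 : (\sum_i w i = 1)%R).

Local Notation cs := (convex_sum w_ge0 w_sum1).

Let convex_sum0 : cs set0 = 0.
Proof. by rewrite /convex_sum big1// => i _; rewrite measure0 mule0. Qed.

Let convex_sum_ge0 U : 0 <= cs U.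
Proof. by apply: sume_ge0 => i _; rewrite mule_ge0 ?lee_fin. Qed.

Let convex_sum_sigma_additive : semi_sigma_additive cs.
Proof.
move=> F mF tF mUF; rewrite /convex_sum.
have -> : (fun n => \sum_(0 <= k < n) \sum_i (w i)%:E * \d_(x i) (F k)) =
    (fun n => \sum_i (w i)%:E * \sum_(0 <= k < n) \d_(x i) (F k)).
  apply/funext => n; rewrite exchange_big/=; apply: eq_bigr => i _.
  by rewrite ge0_sume_distrr.
apply: cvg_nnesum => i _.
  by apply: nearW => n; rewrite mule_ge0 ?lee_fin// sume_ge0.
by apply: cvgeZl => //; exact: measure_semi_sigma_additive.
Qed.

HB.instance Definition _ := isMeasure.Build _ _ _ cs
  convex_sum0 convex_sum_ge0 convex_sum_sigma_additive.

Let convex_sum_setT : cs setT = 1.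
Proof.
rewrite /convex_sum; under eq_bigr do rewrite probability_setT mule1.
by rewrite sumEFin w_sum1.
Qed.

HB.instance Definition _ := Measure_isProbability.Build _ _ _ cs
  convex_sum_setT.

End formal_convex_sum.

(* The set 2 = {0, 1} is ['I_2]. *)
Record multiset2 (K : nat) := Multiset2 {
  mult :> {ffun 'I_2 -> nat} ;
  mult_size : (\sum_x mult x == K)%N }.

HB.instance Definition _ K := [isSub for @mult K].
HB.instance Definition _ K := [Choice of multiset2 K by <:].

Lemma multiset2_of_subproof K (k : 'I_K.+1) :
  (\sum_x [ffun x : 'I_2 => if x == ord0 then k : nat else (K - k)%N] x == K)%N.
Proof. by rewrite big_ord_recl big_ord1 !ffunE/= subnKC// -ltnS. Qed.

(* The bijection from {0, ..., K} that sends k to k|0> + (K - k)|1>. *)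
Definition multiset2_of K (k : 'I_K.+1) : multiset2 K :=
  Multiset2 (multiset2_of_subproof k).

HB.instance Definition _ K := isPointed.Build (multiset2 K) (multiset2_of ord0).

HB.instance Definition _ K := @isMeasurable.Build default_measure_display
  (multiset2 K) discrete_measurable discrete_measurable0
  discrete_measurableC discrete_measurableU.

(* The multiset psi - 1|x>; it is only meaningful when [0 < psi x]. *)
Definition multiset2_del K (psi : multiset2 K.+1) (x : 'I_2) : multiset2 K :=
  insubd (point : multiset2 K) [ffun y => (psi y - (y == x))%N].

Lemma multiset2_delE K (psi : multiset2 K.+1) (x y : 'I_2) : (0 < psi x)%N ->
  multiset2_del psi x y = (psi y - (y == x))%N.
Proof.
move=> psix; rewrite /multiset2_del val_insubd ifT ?ffunE//.
have /eqP := mult_size psi.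
rewrite (bigD1 x)//= => psiE.
rewrite (bigD1 x)//= ffunE eqxx.
rewrite (eq_bigr (fun i => psi i)); last first.
  by move=> i /negPf ix; rewrite ffunE ix subn0.
by rewrite addnC addnBA// addnC psiE subn1.
Qed.

Section draw_delete.
Context (R : realType) (K : nat).

Definition dd_weight (psi : multiset2 K.+1) (x : 'I_2) : R :=
  (psi x)%:R / K.+1%:R.

Lemma dd_weight_ge0 psi x : 0 <= dd_weight psi x.
Proof. by rewrite divr_ge0. Qed.

Lemma dd_weight_sum1 psi : \sum_x dd_weight psi x = 1.
Proof.
by rewrite -mulr_suml -natr_sum (eqP (mult_size psi)) divff.
Qed.

(* The sum ranges over all x in 2, but the terms with [psi x = 0] have
   weight 0. *)
Definition dd_fun (psi : multiset2 K.+1) : pprobability (multiset2 K) R :=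
  (convex_sum (multiset2_del psi) (dd_weight_ge0 psi) (dd_weight_sum1 psi)
   : probability _ _).

Let measurable_dd_fun : measurable_fun [set: multiset2 K.+1] dd_fun.
Proof. by move=> _ A _. Qed.

HB.instance Definition _ := isMeasurableFun.Build _ _ (multiset2 K.+1)
  (pprobability (multiset2 K) R) dd_fun measurable_dd_fun.

Definition draw_delete : channel (multiset2 K.+1) (multiset2 K) R := dd_fun.

End draw_delete.

(* The interval [0, 1], with the subspace topology of the reals and the
   Borel sigma-algebra, i.e., the one generated by the open sets. *)
Definition unit_interval (R : realType) : Type := set_type (`[0%R, 1%R]%classic : set R).

HB.instance Definition _ (R : realType) := Topological.on (unit_interval R).

Definition unit_interval_val (R : realType) (r : unit_interval R) : R :=
  set_val r.

Lemma unit_interval_itv (R : realType) (r : unit_interval R) :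
  0 <= unit_interval_val r <= 1.
Proof. by have := set_valP r; rewrite /= in_itv. Qed.

Lemma mem0_unit_interval (R : realType) : (0 : R) \in (`[0%R, 1%R]%classic : set R).
Proof. by apply/mem_set; rewrite /= in_itv/= lexx ler01. Qed.

HB.instance Definition _ (R : realType) :=
  isPointed.Build (unit_interval R) (SigSub (mem0_unit_interval R)).

HB.instance Definition _ (R : realType) :=
  @isMeasurable.Build (sigma_display (@open (unit_interval R)))
    (unit_interval R) <<s @open (unit_interval R) >>
    (@sigma_algebra0 _ setT _) (@sigma_algebraC _ _)
    (@sigma_algebra_bigcup _ setT _).

Lemma measurable_unit_interval_val (R : realType) :
  measurable_fun [set: unit_interval R] (@unit_interval_val R).
Proof.
apply: (measurability _ (RGenOpens.measurableE R)) => _ [_ [a [b ->] <-]].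
rewrite setTI; apply: sub_sigma_algebra.
by exists `]a, b[%classic => //; exact: interval_open.
Qed.

Section binom.
Context (R : realType) (K : nat).

Definition binom_weight (r : unit_interval R) (k : 'I_K.+1) : R :=
  'C(K, k)%:R * unit_interval_val r ^+ k * (1 - unit_interval_val r) ^+ (K - k).

Lemma binom_weight_ge0 r k : 0 <= binom_weight r k.
Proof.
have /andP[r0 r1] := unit_interval_itv r.
by rewrite !mulr_ge0// exprn_ge0// subr_ge0.
Qed.

Lemma binom_weight_sum1 r : \sum_k binom_weight r k = 1.
Proof.
transitivity ((1 - unit_interval_val r + unit_interval_val r) ^+ K).
  rewrite exprDn; apply: eq_bigr => k _.
  by rewrite /binom_weight -mulrA mulr_natl (mulrC (_ ^+ k)).
by rewrite subrK expr1n.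
Qed.

Definition binom_fun (r : unit_interval R) : pprobability (multiset2 K) R :=
  (convex_sum (@multiset2_of K) (binom_weight_ge0 r) (binom_weight_sum1 r)
   : probability _ _).

Let measurable_binom_fun : measurable_fun [set: unit_interval R] binom_fun.
Proof.
apply: measurable_pprobability => U _.
apply: emeasurable_sum => k; apply: emeasurable_funM => //.
apply/measurable_EFinP; have mr := @measurable_unit_interval_val R.
apply: measurable_funM; first by apply: measurable_funM => //; exact: measurable_funX.
by apply: measurable_funX; exact: measurable_funB.
Qed.

HB.instance Definition _ := isMeasurableFun.Build _ _ (unit_interval R)
  (pprobability (multiset2 K) R) binom_fun measurable_binom_fun.

Definition binom : channel (unit_interval R) (multiset2 K) R := binom_fun.

End binom.

(* Main.v *)
From HB Require Import structures.
Require Import Defs.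
From mathcomp Require Import all_boot all_order all_algebra.
From mathcomp Require Import all_classical all_reals all_analysis.
From mathcomp Require Import measurable_realfun.
From mathcomp Require Import ring lra.

(* The unit interval is a limit because a sequence of distributions on the
   multisets of size K that is coherent under draw-and-delete is the sequence of
   binomial moments of a unique measure on [0, 1] (Hausdorff's moment problem).

   Deleting K - N elements at random from a multiset of size K that contains l
   zeros leaves a fraction of zeros with mean l / K and variance at most 1 / N.
   By Chebyshev's inequality the distribution functions of the fraction of zeros
   at levels N and K thus agree up to a small shift of the argument and an error
   O(1 / min(N, K)), so that they are all sandwiched around a single
   right-continuous function F.  A binomial distribution concentrates in the same
   way, so the binomial moments of the Stieltjes measure of F are sandwiched
   around F too.  Two coherent sequences that are sandwiched around the same
   function coincide: the mass of a multiset of size n is the mean at level N of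
   a function whose increments are at most n / N, and summation by parts bounds
   the difference of two such means by the shift between the distribution
   functions.  Uniqueness holds because the binomial moments of a measure are
   sandwiched around its own distribution function. *)

Set Implicit Arguments.
Unset Strict Implicit.
Unset Printing Implicit Defensive.

Import Order.TTheory GRing.Theory Num.Theory.
Import numFieldNormedType.Exports.

Local Open Scope classical_set_scope.
Local Open Scope ring_scope.

(** * Sequences coherent under draw-and-delete *)

Section draw_delete_cones.
Context {R : realType}.
Implicit Types (p q : nat -> nat -> R) (phi : nat -> R).

(* [p K k] is the mass of k|0> + (K - k)|1>; its values for [k > K] are junk. *)
Record dd_cone p : Prop := DDCone {
  dd_cone_ge0 : forall K k, 0 <= p K k ;
  dd_cone_sum1 : forall K, \sum_(k < K.+1) p K k = 1 ;
  dd_coneE : forall K k, (k <= K)%N ->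
    p K k = (k.+1%:R * p K.+1 k.+1 + (K.+1%:R - k%:R) * p K.+1 k) / K.+1%:R }.

Definition mean p K phi : R := \sum_(k < K.+1) p K k * phi k.

(* At [l = 0] the junk value [phi l.-1] has coefficient 0, and at [l = M.+1] the
   value [phi l] has. *)
Definition dd_step M phi (l : nat) : R :=
  (l%:R * phi l.-1 + (M.+1%:R - l%:R) * phi l) / M.+1%:R.

(** For [l <= N + d] this is the expectation of [phi] at the number of zeros that remain when [d]
    elements are deleted from a multiset of size [N + d] with [l] zeros. *)
Fixpoint dd_steps N d phi : nat -> R :=
  if d is d'.+1 then dd_step (N + d') (dd_steps N d' phi) else phi.

(** [dd_step] is the transpose of the operator in [dd_coneE]. The sums match after an index shift in
    the first one, since the boundary terms have coefficient 0. *)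
Lemma mean_step p M phi : dd_cone p ->
  mean p M phi = mean p M.+1 (dd_step M phi).
Proof.
move=> cp; rewrite /mean.
under eq_bigr => k _ do
  rewrite (dd_coneE cp (ltn_ord k : k <= M)%N) mulrAC mulrDl mulrDl.
rewrite big_split/=.
under [RHS]eq_bigr do rewrite /dd_step mulrA mulrDr mulrDl.
rewrite [RHS]big_split/=; congr (_ + _).
  rewrite [RHS]big_ord_recl/= mul0r mulr0 mul0r add0r.
  by apply: eq_bigr => i _; rewrite /bump/= add1n /= ; ring.
rewrite [RHS]big_ord_recr/= subrr mul0r mulr0 mul0r addr0.
by apply: eq_bigr => i _; ring.
Qed.

Lemma mean_steps p N d phi : dd_cone p ->
  mean p N phi = mean p (N + d) (dd_steps N d phi).
Proof.
move=> cp; elim: d => [|d IH]; first by rewrite addn0.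
by rewrite IH addnS (mean_step _ _ cp).
Qed.

Lemma le_mean p K phi psi : dd_cone p ->
  (forall k, (k <= K)%N -> phi k <= psi k) -> mean p K phi <= mean p K psi.
Proof.
move=> cp h; apply: ler_sum => k _; apply: ler_wpM2l; first exact: dd_cone_ge0.
by apply: h; rewrite -ltnS.
Qed.

Lemma meanD p K phi psi :
  mean p K (fun k => phi k + psi k) = mean p K phi + mean p K psi.
Proof. by rewrite /mean -big_split/=; apply: eq_bigr => k _; rewrite mulrDr. Qed.

Lemma meanN p K phi : mean p K (fun k => - phi k) = - mean p K phi.
Proof. by rewrite /mean -sumrN; apply: eq_bigr => k _; rewrite mulrN. Qed.

Lemma meanZ p K a phi : mean p K (fun k => a * phi k) = a * mean p K phi.
Proof. by rewrite /mean mulr_sumr; apply: eq_bigr => k _; rewrite mulrCA. Qed.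

Lemma mean_cst p K (a : R) : dd_cone p -> mean p K (fun=> a) = a.
Proof. by move=> cp; rewrite /mean -mulr_suml (dd_cone_sum1 cp) mul1r. Qed.

(** One deletion keeps the mean fraction of zeros at [l / (M + 1)] and adds the variance
    [l (M + 1 - l) / (M (M + 1))^2]. Bounding it by [1/M - 1/(M + 1)] makes the errors telescope. *)
Lemma dd_step_quad M phi (a b x e : R) : (0 < M)%N -> 0 <= a ->
  (forall k, (k <= M)%N -> phi k <= b + a * ((k%:R / M%:R - x) ^+ 2 + e)) ->
  forall l, (l <= M.+1)%N ->
  dd_step M phi l <=
    b + a * ((l%:R / M.+1%:R - x) ^+ 2 + (e + M%:R^-1 - M.+1%:R^-1)).
Proof.
move=> M0 a0 h l lM.
have Mr : 0 < M%:R :> R by rewrite ltr0n.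
have Sr : M.+1%:R = M%:R + 1 :> R by rewrite -natr1.
have lr : l%:R <= M.+1%:R :> R by rewrite ler_nat.
have l0 : 0 <= l%:R :> R by [].
have S0 : 0 < M.+1%:R :> R by rewrite ltr0n.
(* A real argument avoids the truncation of [l.-1] at [l = 0], where the coefficient vanishes
   anyway. *)
pose f (y : R) := b + a * ((y / M%:R - x) ^+ 2 + e).
have h1 : l%:R * phi l.-1 <= l%:R * f (l%:R - 1).
  case: l lM {lr l0} => [|l] lM; first by rewrite !mul0r.
  rewrite ler_pM2l ?ltr0n//= -natr1 addrK; exact: h.
have h2 : (M.+1%:R - l%:R) * phi l <= (M.+1%:R - l%:R) * f l%:R.
  move: lM; rewrite leq_eqVlt => /predU1P[->|lM]; first by rewrite subrr !mul0r.
  by apply: ler_wpM2l; [rewrite subr_ge0|exact: h].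
apply: (@le_trans _ _ ((l%:R * f (l%:R - 1) + (M.+1%:R - l%:R) * f l%:R) / M.+1%:R)).
  by rewrite ler_pM2r ?invr_gt0// lerD.
rewrite ler_pdivrMr//.
have m1 : 1 <= M%:R :> R by rewrite ler1n.
move: Mr m1 l0 lr; rewrite Sr /f.
move: (M%:R : R) (l%:R : R) => m u m0 m1 u0 um.
rewrite -subr_ge0.
have -> : (b + a * ((u / (m + 1) - x) ^+ 2 + (e + m^-1 - (m + 1)^-1))) * (m + 1) -
   (u * (b + a * (((u - 1) / m - x) ^+ 2 + e)) +
    (m + 1 - u) * (b + a * ((u / m - x) ^+ 2 + e))) =
   a * (m * (m + 1) - u * (m + 1 - u)) / (m ^+ 2 * (m + 1)).
  by field; rewrite ?gt_eqF//; lra.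
apply: divr_ge0; last by rewrite mulr_ge0 ?exprn_ge0//; lra.
(* [u (m + 1 - u)] is at most [(m + 1)^2 / 4], hence at most [m (m + 1)] as [m >= 1]. *)
by apply: mulr_ge0 => //; nra.
Qed.

(** The induction keeps the telescoped error [1/N - 1/(N + d)]; it is weakened to [1/N] only at the
    end. *)
Lemma dd_steps_quad N d phi (a b x : R) : (0 < N)%N -> 0 <= a ->
  (forall k, (k <= N)%N -> phi k <= b + a * (k%:R / N%:R - x) ^+ 2) ->
  forall l, (l <= N + d)%N ->
  dd_steps N d phi l <= b + a * ((l%:R / (N + d)%:R - x) ^+ 2 + N%:R^-1).
Proof.
move=> N0 a0 h.
suff H l : (l <= N + d)%N -> dd_steps N d phi l <=
    b + a * ((l%:R / (N + d)%:R - x) ^+ 2 + (N%:R^-1 - (N + d)%:R^-1)).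
  move=> l lN; apply: (le_trans (H _ lN)).
  by rewrite lerD2l ler_wpM2l// lerD2l lerBlDr lerDl invr_ge0.
elim: d l => [|d IH] l lN.
  by rewrite addn0 subrr addr0; apply: h; rewrite -(addn0 N).
have := @dd_step_quad (N + d) (dd_steps N d phi) a b x (N%:R^-1 - (N + d)%:R^-1).
rewrite addn_gt0 N0 => /(_ isT a0 IH l); rewrite addnS in lN *; move=> /(_ lN).
by rewrite subrK.
Qed.

Definition cdf_lt p N j : R := mean p N (fun k => (k < j)%:R).

(* Chebyshev's bound for a deviation of [j / N] from [t], with variance at
   most [1 / N]. *)
Definition dev_bound N j (t : R) : R := N%:R / (j%:R - t * N%:R) ^+ 2.

Lemma dev_bound_ge0 N j t : 0 <= dev_bound N j t.
Proof. by rewrite divr_ge0// sqr_ge0. Qed.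

Lemma dev_boundE N j t : (0 < N)%N ->
  dev_bound N j t = N%:R^-1 / (j%:R / N%:R - t) ^+ 2.
Proof.
move=> N0; rewrite /dev_bound; have N0r : (N%:R : R) != 0 by rewrite pnatr_eq0 -lt0n.
have -> : j%:R - t * N%:R = (j%:R / N%:R - t) * N%:R :> R by rewrite mulrBl divfK.
have NE : N%:R / N%:R ^+ 2 = N%:R^-1 :> R by field.
by rewrite exprMn invfM mulrCA NE mulrC.
Qed.

Lemma dd_step_le M phi psi :
  (forall k, (k <= M)%N -> phi k <= psi k) ->
  forall l, (l <= M.+1)%N -> dd_step M phi l <= dd_step M psi l.
Proof.
move=> h l lM; rewrite ler_pM2r ?invr_gt0 ?ltr0n// lerD//.
  case: l lM => [|l] lM; first by rewrite !mul0r.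
  by rewrite ler_wpM2l//; exact: h.
move: lM; rewrite leq_eqVlt => /predU1P[->|lM]; first by rewrite subrr !mul0r.
by apply: ler_wpM2l; [rewrite subr_ge0 ler_nat ltnW|exact: h].
Qed.

Lemma dd_steps_le N d phi psi :
  (forall k, (k <= N)%N -> phi k <= psi k) ->
  forall l, (l <= N + d)%N -> dd_steps N d phi l <= dd_steps N d psi l.
Proof.
move=> h; elim: d => [|d IH] l; first by rewrite addn0; exact: h.
by rewrite addnS => lN; exact: dd_step_le.
Qed.

Lemma dd_steps_cst N d (a : R) l : dd_steps N d (fun=> a) l = a.
Proof.
elim: d l => [|d IH] l //=.
by rewrite /dd_step !IH -mulrDl addrC subrK mulrAC divff// mul1r.
Qed.

Lemma sqr_ratio_ge1 (x y : R) : 0 < x -> x <= y -> 1 <= y ^+ 2 / x ^+ 2.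
Proof.
move=> x0 xy; rewrite ler_pdivlMr ?exprn_gt0// mul1r ler_sqr// nnegrE ltW//.
exact: lt_le_trans xy.
Qed.

(** Chebyshev: with [x = l / (N + d)], the indicator of [k < j] is at most [(k/N - x)^2 / y^2], and
    at [l] only the variance term of [dd_steps_quad] survives. *)
Lemma dd_steps_lt_le N d j l (y : R) : (0 < N)%N -> (l <= N + d)%N ->
  0 < y -> y <= l%:R / (N + d)%:R - j%:R / N%:R ->
  dd_steps N d (fun k => (k < j)%:R) l <= N%:R^-1 / y ^+ 2.
Proof.
move=> N0 lN y0 yl.
have := @dd_steps_quad N d (fun k => (k < j)%:R) (y ^+ 2)^-1 0 (l%:R / (N + d)%:R) N0.
rewrite invr_ge0 sqr_ge0 => /(_ isT) H.
rewrite mulrC; apply: (le_trans (H _ _ _)) => //; last first.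
  by rewrite add0r subrr expr0n/= add0r.
move=> k kN; rewrite add0r; case: ltnP => [kj|_]; last first.
  by rewrite mulr_ge0// ?invr_ge0 sqr_ge0.
rewrite mulrC -sqrrN opprB; apply: sqr_ratio_ge1 => //.
apply: (le_trans yl); rewrite lerD2l lerN2 ler_pM2r ?invr_gt0 ?ltr0n//.
by rewrite ler_nat ltnW.
Qed.

Lemma dd_stepsN N d phi l :
  dd_steps N d (fun k => - phi k) l = - dd_steps N d phi l.
Proof.
elim: d l => [|d IH] l //=.
by rewrite /dd_step !IH !mulrN -opprD mulNr.
Qed.

(** The same bound on the other side, obtained by applying [dd_steps_quad] to the negated indicator
    with [b = -1]. *)
Lemma dd_steps_lt_ge N d j l (y : R) : (0 < N)%N -> (l <= N + d)%N ->
  0 < y -> y <= j%:R / N%:R - l%:R / (N + d)%:R ->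
  1 - N%:R^-1 / y ^+ 2 <= dd_steps N d (fun k => (k < j)%:R) l.
Proof.
move=> N0 lN y0 yl.
have := @dd_steps_quad N d (fun k => - (k < j)%:R) (y ^+ 2)^-1 (-1)
  (l%:R / (N + d)%:R) N0.
rewrite invr_ge0 sqr_ge0 => /(_ isT) H.
rewrite -[leRHS]opprK -dd_stepsN lerNr opprB.
apply: (le_trans (H _ _ _)) => //; last first.
  by rewrite subrr expr0n/= add0r addrC mulrC.
move=> k kN; case: ltnP => [_|jk]; first by rewrite lerDl mulr_ge0// ?invr_ge0 sqr_ge0.
rewrite oppr0 addrC subr_ge0 mulrC; apply: sqr_ratio_ge1 => //.
apply: (le_trans yl); rewrite lerD2r ler_pM2r ?invr_gt0 ?ltr0n//.
by rewrite ler_nat.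
Qed.

Lemma cdf_lt_ge0 p N j : dd_cone p -> 0 <= cdf_lt p N j.
Proof. by move=> cp; apply: sumr_ge0 => k _; rewrite mulr_ge0// dd_cone_ge0. Qed.

Lemma cdf_lt_le1 p N j : dd_cone p -> cdf_lt p N j <= 1.
Proof.
move=> cp; rewrite -[leRHS](mean_cst N 1 cp).
by apply: le_mean => // k _; rewrite lern1 leq_b1.
Qed.

Lemma cdf_lt_mono p N i j : dd_cone p -> (i <= j)%N -> cdf_lt p N i <= cdf_lt p N j.
Proof.
move=> cp ij; apply: le_mean => // k _; rewrite ler_nat; case: (ltnP k i) => // ki.
by rewrite (leq_trans ki ij).
Qed.

Lemma cdf_lt0 p N : cdf_lt p N 0 = 0.
Proof. by apply: big1 => k _; rewrite mulr0. Qed.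

Lemma cdf_lt_full p N j : dd_cone p -> (N < j)%N -> cdf_lt p N j = 1.
Proof.
move=> cp Nj; rewrite -[RHS](mean_cst N 1 cp); apply: eq_bigr => k _.
by rewrite (leq_trans (ltn_ord k)).
Qed.

Lemma invr_sqr_le (e x y : R) : 0 <= e -> 0 < x -> x <= y -> e / y ^+ 2 <= e / x ^+ 2.
Proof.
move=> e0 x0 xy; rewrite ler_wpM2l// lef_pV2 ?posrE ?exprn_gt0//; last first.
  exact: lt_le_trans xy.
by rewrite ler_sqr// nnegrE ltW//; exact: lt_le_trans xy.
Qed.

(** The indicator at the coarser level is carried to the finer one by [mean_steps] and compared
    there pointwise with the finer indicator. Where they could disagree, the fractions are at least
    [y] apart; [y] exceeds both distances to [t], so the error fits into the [dev_bound] of the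
    coarser level. *)
Lemma cdf_lt_le p N K i j t : dd_cone p -> (0 < N)%N -> (0 < K)%N ->
  j%:R < t * N%:R -> t * K%:R < i%:R ->
  cdf_lt p N j <= cdf_lt p K i + dev_bound N j t + dev_bound K i t.
Proof.
move=> cp N0 K0 jt0 ti0.
have jt : j%:R / N%:R < t by rewrite ltr_pdivrMr ?ltr0n.
have ti : t < i%:R / K%:R by rewrite ltr_pdivlMr ?ltr0n.
pose y : R := i%:R / K%:R - j%:R / N%:R.
have y0 : 0 < y by rewrite subr_gt0 (lt_trans jt).
have [NK|KN] := leqP N K.
  apply: (@le_trans _ _ (cdf_lt p K i + N%:R^-1 / y ^+ 2)); last first.
    rewrite -addrA lerD2l (le_trans _ (ler_wpDr _ (lexx _))) ?dev_bound_ge0//.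
    rewrite dev_boundE// -(sqrrN (_ - t)) opprB; apply: invr_sqr_le => //.
      by rewrite subr_gt0.
    by rewrite lerD2r ltW.
  rewrite /cdf_lt -(subnKC NK) (mean_steps N (K - N) _ cp) subnKC//.
  rewrite -[X in _ + X](mean_cst K _ cp) -meanD; apply: le_mean => // l lK.
  have [li|il] := ltnP l i.
    rewrite (@le_trans _ _ 1)//; last first.
      by rewrite lerDl divr_ge0// sqr_ge0.
    rewrite -[leRHS](dd_steps_cst N (K - N) 1 l).
    apply: dd_steps_le; last by rewrite subnKC.
    by move=> k _; rewrite lern1 leq_b1.
  rewrite add0r; apply: dd_steps_lt_le => //; rewrite subnKC//.
  by rewrite lerD2r ler_pM2r ?invr_gt0 ?ltr0n// ler_nat.
apply: (@le_trans _ _ (cdf_lt p K i + K%:R^-1 / y ^+ 2)); last first.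
  rewrite -addrA lerD2l (le_trans _ (ler_wpDl _ (lexx _))) ?dev_bound_ge0//.
  rewrite dev_boundE//; apply: invr_sqr_le => //.
    by rewrite subr_gt0.
  by rewrite lerD2l lerN2 ltW.
rewrite -lerBlDr /cdf_lt [leRHS](mean_steps K (N - K) _ cp) subnKC ?(ltnW KN)//.
rewrite -[X in _ - X](mean_cst N _ cp) -meanN -meanD; apply: le_mean => // l lN.
have [lj|jl] := ltnP l j.
  apply: dd_steps_lt_ge => //; rewrite subnKC ?(ltnW KN)//.
  by rewrite lerD2l lerN2 ler_pM2r ?invr_gt0 ?ltr0n// ler_nat ltnW.
apply: (@le_trans _ _ 0); first by rewrite add0r oppr_le0 divr_ge0// sqr_ge0.
rewrite -[leLHS](dd_steps_cst K (N - K) 0 l); apply: dd_steps_le => //.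
by rewrite subnKC// ltnW.
Qed.

End draw_delete_cones.

(** * Comparison of coherent sequences through their distribution functions *)

Section comparison_of_cones.
Context {R : realType}.
Implicit Types (p q : nat -> nat -> R) (phi : nat -> R).

(** An increment of [dd_step] combines two neighbouring increments with weights [l / (M + 1)] and
    [(M - l) / (M + 1)]. Their total [M / (M + 1)] telescopes to [N / (N + d)] over [d] steps. *)
Lemma dd_step_lipschitz M phi (e : R) :
  (forall l, (l < M)%N -> `|phi l.+1 - phi l| <= e) ->
  forall l, (l < M.+1)%N ->
  `|dd_step M phi l.+1 - dd_step M phi l| <= M%:R * e / M.+1%:R.
Proof.
move=> h l lM.
have -> : dd_step M phi l.+1 - dd_step M phi l =
    (l%:R * (phi l - phi l.-1) + (M%:R - l%:R) * (phi l.+1 - phi l)) / M.+1%:R.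
  by rewrite /dd_step/= -!natr1; field; rewrite natr1.
rewrite normrM normfV [`|M.+1%:R|]normr_nat ler_pM2r ?invr_gt0 ?ltr0n//.
have -> : M%:R * e = l%:R * e + (M%:R - l%:R) * e by ring.
apply: (le_trans (ler_normD _ _)); rewrite !normrM; apply: lerD.
  case: l lM => [|l] lM; first by rewrite normr0 !mul0r.
  by rewrite normr_nat ler_wpM2l//; exact: h.
move: lM; rewrite ltnS leq_eqVlt => /predU1P[->|lM]; first by rewrite subrr normr0 !mul0r.
rewrite ger0_norm ?subr_ge0 ?ler_nat ?(ltnW lM)//.
by rewrite ler_wpM2l ?subr_ge0 ?ler_nat ?(ltnW lM)//; exact: h.
Qed.

Lemma dd_steps_lipschitz N d phi : (0 < N)%N ->
  (forall l, (l < N)%N -> `|phi l.+1 - phi l| <= 1) ->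
  forall l, (l < N + d)%N ->
  `|dd_steps N d phi l.+1 - dd_steps N d phi l| <= N%:R / (N + d)%:R.
Proof.
move=> N0 h; elim: d => [|d IH] l lN.
  rewrite addn0 divff ?pnatr_eq0 -?lt0n//; apply: h; by rewrite -(addn0 N).
rewrite addnS in lN *; apply: (le_trans (dd_step_lipschitz IH lN)).
by rewrite mulrCA divff ?mulr1// pnatr_eq0 -lt0n addn_gt0 N0.
Qed.

(** Abel summation: [phi k] is [phi N] minus the increments from [k] on, and exchanging the sums
    turns the indicators into [cdf_lt]. *)
Lemma mean_by_parts p N phi : dd_cone p ->
  mean p N phi = phi N - \sum_(i < N) (phi i.+1 - phi i) * cdf_lt p N i.+1.
Proof.
move=> cp.
have H k : (k <= N)%N ->
    phi k = phi N - \sum_(i < N) (phi i.+1 - phi i) * (k < i.+1)%:R.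
  move=> kN; rewrite -(big_mkord xpredT (fun i => (phi i.+1 - phi i) * (k < i.+1)%:R)).
  rewrite (big_cat_nat _ kN)//= big_nat big1 ?add0r; last first.
    by move=> i /andP[_ ik]; rewrite ltnS leqNgt ik mulr0.
  rewrite (eq_big_nat _ _ (F2 := fun i => phi i.+1 - phi i)); last first.
    by move=> i /andP[ki _]; rewrite ltnS ki mulr1.
  by rewrite telescope_sumr// subKr.
rewrite /mean (eq_bigr (fun k : 'I_N.+1 => p N k * phi N -
   \sum_(i < N) (phi i.+1 - phi i) * (p N k * (k < i.+1)%:R))); last first.
  move=> k _; rewrite {1}(H k) -1?ltnS// mulrBr mulr_sumr; congr (_ - _).
  by apply: eq_bigr => i _; rewrite mulrCA.
rewrite sumrB -mulr_suml (dd_cone_sum1 cp) mul1r exchange_big/=; congr (_ - _).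
by apply: eq_bigr => i _; rewrite -mulr_sumr.
Qed.

(** A shift by [D] is made of [D] unit shifts, each telescoping to a difference of two values of
    [f]. *)
Lemma sum_shift_le (f : nat -> R) N D : (forall i, 0 <= f i <= 1) ->
  \sum_(i < N) (f (i + D)%N - f i) <= D%:R.
Proof.
move=> f01; elim: D => [|D IH].
  by rewrite big1// => i _; rewrite addn0 subrr.
have -> : \sum_(i < N) (f (i + D.+1)%N - f i) =
    \sum_(i < N) (f (i.+1 + D)%N - f (i + D)%N) + \sum_(i < N) (f (i + D)%N - f i).
  by rewrite -big_split/=; apply: eq_bigr => i _; rewrite addnS addSn addrA subrK.
rewrite -natr1 addrC lerD//.
rewrite -(big_mkord xpredT (fun i => f (i.+1 + D)%N - f (i + D)%N)).
rewrite (telescope_sumr (fun i => f (i + D)%N))//.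
have := f01 (N + D)%N; have := f01 (0 + D)%N; lra.
Qed.

(** The constant 8 leaves room for two Chebyshev bounds at the midpoint of [i] and [j], each equal
    to [4 N / (i - j)^2]. *)
Definition close_cdfs p q := forall N i j, (0 < N)%N -> (j < i)%N ->
  cdf_lt q N j <= cdf_lt p N i + 8 * N%:R / (i%:R - j%:R) ^+ 2.

(** After summation by parts, [2 D] is the cost of shifting the distribution function by [D] both
    ways, and the other term is the error of [close_cdfs] summed over [N] indices. *)
Lemma mean_dist p q N D phi (e : R) : dd_cone p -> dd_cone q ->
  close_cdfs p q -> close_cdfs q p -> (0 < N)%N -> (0 < D)%N ->
  0 <= e -> (forall l, (l < N)%N -> `|phi l.+1 - phi l| <= e) ->
  `|mean p N phi - mean q N phi| <= e * (2 * D%:R + N%:R * (8 * N%:R / D%:R ^+ 2)).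
Proof.
move=> cp cq pq qp N0 D0 e0 h.
rewrite !mean_by_parts// opprB addrC addrA subrK -sumrB.
under eq_bigr do rewrite -mulrBr.
apply: (le_trans (ler_norm_sum _ _ _)).
(* With this offset, [f i] and [f (i + D.*2)] are the values at [i.+1 - D] and [i.+1 + D], which
   enclose both distribution functions at [i.+1] up to the error. *)
pose f i := cdf_lt p N (i.+1 - D).
have qpD i : `|cdf_lt q N i.+1 - cdf_lt p N i.+1| <=
    (f (i + D.*2)%N - f i) + 8 * N%:R / D%:R ^+ 2.
  have E1 : ((i + D.*2).+1 - D = i.+1 + D)%N.
    by rewrite -addSn -addnn addnA addnK.
  have DE k : (k + D)%:R - k%:R = D%:R :> R by rewrite natrD addrC addKr.
  rewrite /f E1.
  have h1 : cdf_lt q N i.+1 <= cdf_lt p N (i.+1 + D) + 8 * N%:R / D%:R ^+ 2.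
    by rewrite -(DE i.+1); apply: pq => //; rewrite -[X in (X < _)%N]addn0 ltn_add2l.
  have h2 : cdf_lt p N (i.+1 - D) <= cdf_lt q N i.+1 + 8 * N%:R / D%:R ^+ 2.
    (* If the subtraction truncates to 0, then [cdf_lt] is 0 and the bound is immediate. *)
    have [iD|Di] := leqP i.+1 D.
      have -> : (i.+1 - D = 0)%N by apply/eqP.
      by rewrite cdf_lt0 addr_ge0 ?cdf_lt_ge0// divr_ge0// sqr_ge0.
    rewrite -(DE (i.+1 - D)%N) subnK ?(ltnW Di)//; apply: qp => //.
    by rewrite ltn_subrL D0.
  have h3 : cdf_lt p N (i.+1 - D) <= cdf_lt p N i.+1.
    by apply: cdf_lt_mono => //; exact: leq_subr.
  have h4 : cdf_lt p N i.+1 <= cdf_lt p N (i.+1 + D).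
    by apply: cdf_lt_mono => //; exact: leq_addr.
  by rewrite ler_norml; apply/andP; split; lra.
apply: (@le_trans _ _ (\sum_(i < N) e * ((f (i + D.*2)%N - f i) + 8 * N%:R / D%:R ^+ 2))).
  by apply: ler_sum => i _; rewrite normrM ler_pM// h.
rewrite -mulr_sumr ler_wpM2l// big_split/= sumr_const card_ord.
rewrite -[(8 * _ / _) *+ N]mulr_natl lerD2r.
have -> : 2 * D%:R = D.*2%:R :> R by rewrite -mul2n natrM.
by apply: sum_shift_le => i; rewrite /f cdf_lt_ge0// cdf_lt_le1.
Qed.

Lemma close_cdfs_eq p q : dd_cone p -> dd_cone q ->
  close_cdfs p q -> close_cdfs q p ->
  forall n k, (k <= n)%N -> p n k = q n k.
Proof.
(* Level 0 is treated apart because [dd_steps_lipschitz] starts at a positive level; its only mass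
   is 1. *)
move=> cp cq pq qp [|n] k kn.
  move: kn; rewrite leqn0 => /eqP->.
  by have := dd_cone_sum1 cp 0; have := dd_cone_sum1 cq 0; rewrite !big_ord1 => -> ->.
(* The bound of [mean_dist] tends to 0 for [N = M ^ 4] and [D = M ^ 3]. *)
pose phi i : R := (i == k)%:R.
have phiE r : r n.+1 k = mean r n.+1 phi.
  rewrite /mean (bigD1 (Ordinal (kn : k < n.+2)%N))//= /phi eqxx mulr1 big1 ?addr0//.
  move=> i; rewrite -val_eqE/= => /negPf ->; exact: mulr0.
rewrite !phiE; apply/eqP; rewrite -subr_eq0 -normr_eq0; apply/eqP/le_anti.
rewrite normr_ge0 andbT leNgt; apply/negP; set x := `|_| => x0.
(* The bound is [2 (n + 1) / M + 8 (n + 1) / M^2], whence 10. *)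
have key M : (n < M)%N -> x <= 10 * n.+1%:R / M%:R.
  move=> nM; have M0 : (0 < M)%N by exact: leq_trans nM.
  have nM4 : (n.+1 <= M ^ 4)%N.
    by apply: (leq_trans nM); rewrite -{1}(expn1 M) leq_pexp2l.
  rewrite /x !(mean_steps n.+1 (M ^ 4 - n.+1))// subnKC//.
  have N0 : (0 < M ^ 4)%N by rewrite expn_gt0 M0.
  have D0 : (0 < M ^ 3)%N by rewrite expn_gt0 M0.
  have h : forall l, (l < M ^ 4)%N ->
      `|dd_steps n.+1 (M ^ 4 - n.+1) phi l.+1 - dd_steps n.+1 (M ^ 4 - n.+1) phi l|
      <= n.+1%:R / (M ^ 4)%:R.
    move=> l lN; have := @dd_steps_lipschitz n.+1 (M ^ 4 - n.+1) phi isT _ l.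
    rewrite subnKC//; apply => // i _; rewrite /phi.
    by case: eqP; case: eqP; rewrite ?subrr ?subr0 ?sub0r ?normrN ?normr0 ?normr1.
  apply: (le_trans (mean_dist cp cq pq qp N0 D0 _ h)); first by rewrite divr_ge0.
  rewrite !natrX; have m0 : 1 <= M%:R :> R by rewrite ler1n.
  have n0 : 0 <= n.+1%:R :> R by [].
  move: (M%:R : R) (n.+1%:R : R) m0 n0 => m u m1 u0.
  have mn0 : m != 0 by rewrite gt_eqF//; lra.
  rewrite -subr_ge0.
  have -> : 10 * u / m - u / m ^+ 4 *
      (2 * m ^+ 3 + m ^+ 4 * (8 * m ^+ 4 / (m ^+ 3) ^+ 2)) =
     8 * u * (m - 1) / m ^+ 2 by field.
  by rewrite divr_ge0 ?sqr_ge0// mulr_ge0//; lra.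
pose M := (Num.truncn (10 * n.+1%:R / x)).+1.
have lM : 10 * n.+1%:R / x < M%:R.
  by have := truncnS_gt (10 * n.+1%:R / x).
have := key (maxn M n.+1) (leq_maxr _ _); apply/negP; rewrite -ltNge.
rewrite ltr_pdivrMr ?ltr0n ?leq_max ?orbT// [x * _]mulrC -ltr_pdivrMr//.
by apply: (lt_le_trans lM); rewrite ler_nat leq_maxl.
Qed.

(** [j = t N] is excluded: there [dev_bound] is 0 by the convention for division by 0. *)
Definition sandwich p (G : R -> R) := forall N j t, (0 < N)%N ->
  (j%:R < t * N%:R -> cdf_lt p N j <= G t + dev_bound N j t) /\
  (t * N%:R < j%:R -> G t <= cdf_lt p N j + dev_bound N j t).

Lemma sandwich_close p q G : sandwich p G -> sandwich q G -> close_cdfs p q.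
Proof.
move=> pG qG N i j N0 ji.
pose t : R := (i%:R + j%:R) / 2 / N%:R.
have N0r : N%:R != 0 :> R by rewrite pnatr_eq0 -lt0n.
have tN : t * N%:R = (i%:R + j%:R) / 2 by rewrite /t divfK.
have ijr : j%:R < i%:R :> R by rewrite ltr_nat.
have [_ /(_ _)h1] := pG N i t N0; have [/(_ _)h2 _] := qG N j t N0.
rewrite /dev_bound tN in h1 h2.
have {}h1 := h1 ltac:(lra); have {}h2 := h2 ltac:(lra).
apply: (le_trans h2); rewrite -lerBrDr; apply: (le_trans h1).
rewrite -subr_ge0 le_eqVlt; apply/orP; left; apply/eqP.
by field; rewrite ?subr_eq0; lra.
Qed.

Lemma sandwich_unique p q G : dd_cone p -> dd_cone q ->
  sandwich p G -> sandwich q G -> forall n k, (k <= n)%N -> p n k = q n k.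
Proof.
move=> cp cq pG qG.
exact: (close_cdfs_eq cp cq (sandwich_close pG qG) (sandwich_close qG pG)).
Qed.

(** Both functions are compared with the same [cdf_lt p N j], where [j / N] is close to the midpoint
    of [s] and [t]; the Chebyshev errors vanish as [N] grows. *)
Lemma sandwich_le p G H s t : sandwich p G -> sandwich p H ->
  0 <= s -> s < t -> G s <= H t.
Proof.
move=> pG pH s0 st; rewrite leNgt; apply/negP => HG.
pose e := G s - H t; have e0 : 0 < e by rewrite subr_gt0.
pose h := t - s; have h0 : 0 < h by rewrite subr_gt0.
(* As [j] lies at most 1 above the midpoint [u], it is at least [h N / 2] away from [s N] and, since
   [h N >= 4], at least [h N / 4] away from [t N]; this gives 4 + 16 = 20. *)
have key N : (0 < N)%N -> 4 <= h * N%:R -> e <= 20 / (h ^+ 2 * N%:R).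
  move=> N0 hN; have N0r : 0 < N%:R :> R by rewrite ltr0n.
  pose u := (s + t) / 2 * N%:R; pose j := (Num.truncn u).+1.
  have u0 : 0 <= u by rewrite mulr_ge0//; lra.
  have ju : u < j%:R by exact: truncnS_gt.
  have uj : j%:R <= u + 1 by rewrite -natr1 lerD2r truncn_le.
  have [_ h1] := pG N j s N0; have [h2 _] := pH N j t N0.
  have us : u - s * N%:R = h * N%:R / 2 by rewrite /u /h; field.
  have ut : t * N%:R - u = h * N%:R / 2 by rewrite /u /h; field.
  have {}h1 := h1 ltac:(lra); have {}h2 := h2 ltac:(lra).
  have x0 : 0 < h * N%:R by rewrite mulr_gt0.
  have b1 : dev_bound N j s <= N%:R / (h * N%:R / 2) ^+ 2.
    by apply: invr_sqr_le => //; lra.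
  have b2 : dev_bound N j t <= N%:R / (h * N%:R / 4) ^+ 2.
    by rewrite /dev_bound -sqrrN; apply: invr_sqr_le => //; lra.
  have -> : 20 / (h ^+ 2 * N%:R) =
      N%:R / (h * N%:R / 2) ^+ 2 + N%:R / (h * N%:R / 4) ^+ 2.
    by field; rewrite !gt_eqF.
  by rewrite /e; lra.
pose N := (Num.truncn (Num.max (4 / h) (20 / (h ^+ 2 * e)))).+1.
have := truncnS_gt (Num.max (4 / h) (20 / (h ^+ 2 * e))).
rewrite -/N gt_max => /andP[N1 N2].
have N0 : 0 < N%:R :> R by rewrite ltr0n.
have := key N isT; rewrite mulrC -ler_pdivrMr// => /(_ (ltW N1)); apply/negP.
rewrite -ltNge ltr_pdivrMr ?mulr_gt0 ?exprn_gt0//.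
move: N2; rewrite ltr_pdivrMr ?mulr_gt0 ?exprn_gt0//.
by congr (_ < _); ring.
Qed.

End comparison_of_cones.

(** * The limiting distribution function *)

Section limit_cdf.
Context {R : realType}.
Implicit Types (p : nat -> nat -> R).

(* An infimum of Chebyshev bounds, rather than a limit of the distribution
   functions, makes right-continuity and measurability in [p] immediate. *)
Definition cdf_bounds p (t : R) : set R :=
  [set x | exists N j, [/\ (0 < N)%N, t * N%:R < j%:R
                         & x = cdf_lt p N j + dev_bound N j t]].

Definition limit_cdf p (t : R) : R := inf (cdf_bounds p t).

Context (p : nat -> nat -> R) (cp : dd_cone p).

Lemma cdf_bounds_neq0 t : cdf_bounds p t !=set0.
Proof.
pose j := (Num.truncn t).+1; exists (cdf_lt p 1 j + dev_bound 1 j t), 1%N, j.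
by split => //; rewrite mulr1 truncnS_gt.
Qed.

Lemma lbound_cdf_bounds t : lbound (cdf_bounds p t) 0.
Proof. by move=> _ [N [j [? ? ->]]]; rewrite addr_ge0 ?cdf_lt_ge0 ?dev_bound_ge0. Qed.

Lemma limit_cdf_le N j t : (0 < N)%N -> t * N%:R < j%:R ->
  limit_cdf p t <= cdf_lt p N j + dev_bound N j t.
Proof.
move=> N0 tj; apply: ge_inf; last by exists N, j.
by exists 0; exact: lbound_cdf_bounds.
Qed.

Lemma le_limit_cdf (a t : R) :
  (forall N j, (0 < N)%N -> t * N%:R < j%:R -> a <= cdf_lt p N j + dev_bound N j t) ->
  a <= limit_cdf p t.
Proof.
move=> h; apply: lb_le_inf; first exact: cdf_bounds_neq0.
by move=> _ [N [j [? ? ->]]]; exact: h.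
Qed.

Lemma limit_cdf_lt (a t : R) : limit_cdf p t < a <->
  exists N j, [/\ (0 < N)%N, t * N%:R < j%:R & cdf_lt p N j + dev_bound N j t < a].
Proof.
split=> [ta|[N [j [N0 tj]]]]; last by apply: le_lt_trans; exact: limit_cdf_le.
have [] := inf_lt (cdf_bounds_neq0 t) ta.
by move=> _ [N [j [N0 tj ->]]] ?; exists N, j.
Qed.

Lemma limit_cdf_ge0 t : 0 <= limit_cdf p t.
Proof.
by apply: le_limit_cdf => N j *; rewrite addr_ge0 ?cdf_lt_ge0 ?dev_bound_ge0.
Qed.

(** For negative [t] the index [j = 0] is admissible at every [N] and gives the bound
    [1 / (t^2 N)]. *)
Lemma limit_cdf_lt0 t : t < 0 -> limit_cdf p t = 0.
Proof.
move=> t0; apply/le_anti; rewrite limit_cdf_ge0 andbT leNgt; apply/negP => F0.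
pose N := (Num.truncn (limit_cdf p t * t ^+ 2)^-1).+1.
have tN := truncnS_gt (limit_cdf p t * t ^+ 2)^-1.
have N0 : 0 < N%:R :> R by rewrite ltr0n.
have t2 : 0 < t ^+ 2 by rewrite exprn_even_gt0//= lt_eqF.
have := @limit_cdf_le N 0 t isT; rewrite nmulr_rlt0// N0 => /(_ isT); apply/negP.
move: tN; rewrite -ltNge cdf_lt0 add0r /dev_bound sub0r sqrrN -/N.
rewrite -[_^-1]mul1r (ltr_pdivrMr _ _ (mulr_gt0 F0 t2)) => tN.
have tN2 : 0 < (t * N%:R) ^+ 2.
  by rewrite exprn_even_gt0//= mulf_eq0 (lt_eqF t0) (gt_eqF N0).
rewrite (ltr_pdivrMr _ _ tN2).
have -> : limit_cdf p t * (t * N%:R) ^+ 2 =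
    N%:R * (N%:R * (limit_cdf p t * t ^+ 2)) by ring.
by rewrite ltr_pMr.
Qed.

(** From above, [N = 1] and a large [j] make the deviation term small; from below, every admissible
    [j] exceeds [N], so that [cdf_lt] is 1. *)
Lemma limit_cdf_ge1 t : 1 <= t -> limit_cdf p t = 1.
Proof.
move=> t1; apply/le_anti/andP; split.
  apply/ler_addgt0Pr => e e0.
  pose x := Num.max (t + 1) (t + e^-1).
  pose j := (Num.truncn x).+1.
  have := truncnS_gt x; rewrite -/j gt_max => /andP[j1 j2].
  have tj : t * 1%:R < j%:R by rewrite mulr1; lra.
  apply: (le_trans (limit_cdf_le _ tj)) => //; apply: lerD; first exact: cdf_lt_le1.
  rewrite /dev_bound mulr1 ler_pdivrMr; last by rewrite exprn_gt0//; lra.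
  have h1 : 1 < j%:R - t by lra.
  have h2 : 1 <= e * (j%:R - t).
    by rewrite mulrC -ler_pdivrMr// mul1r; lra.
  by apply: (le_trans h2); rewrite ler_pM2l// expr2 ler_peMr//; lra.
apply: le_limit_cdf => N j N0 tj; rewrite cdf_lt_full//.
  by rewrite lerDl dev_bound_ge0.
by rewrite -(ltr_nat R); apply: le_lt_trans tj; rewrite ler_peMl.
Qed.

Lemma limit_cdf_nd : nondecreasing (limit_cdf p).
Proof.
move=> s t st; apply: le_limit_cdf => N j N0 tj.
have N0r : 0 < N%:R :> R by rewrite ltr0n.
have sN : s * N%:R <= t * N%:R by rewrite ler_pM2r.
apply: (le_trans (limit_cdf_le N0 (le_lt_trans sN tj))); rewrite lerD2l.
by apply: invr_sqr_le => //; lra.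
Qed.

(** A single bound within [e] of the infimum at [x] stays admissible and varies continuously near
    [x]; monotonicity gives the other inequality. *)
Lemma limit_cdf_rc : right_continuous (limit_cdf p).
Proof.
move=> x; apply/cvgrPdist_lt => e e0.
have [N [j [N0 xj xe]]] : exists N j, [/\ (0 < N)%N, x * N%:R < j%:R &
    cdf_lt p N j + dev_bound N j x < limit_cdf p x + e].
  by apply/limit_cdf_lt; rewrite ltrDl.
have cj : (fun t => j%:R - t * N%:R) @ x --> j%:R - x * N%:R.
  by apply: cvgB; [exact: cvg_cst|apply: cvgMl; exact: cvg_id].
have cb : (fun t => cdf_lt p N j + dev_bound N j t) @ x -->
    cdf_lt p N j + dev_bound N j x.
  apply: cvgD; first exact: cvg_cst.
  apply: cvgM; first exact: cvg_cst.
  apply: cvgV; first by rewrite expf_neq0// gt_eqF// subr_gt0.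
  by rewrite expr2; under eq_fun do rewrite expr2; exact: cvgM.
near=> t.
have xt : x <= t by near: t; exact: nbhs_right_ge.
rewrite ler0_norm; last by rewrite subr_le0 limit_cdf_nd.
rewrite opprB ltrBlDl addrC; apply/limit_cdf_lt; exists N, j; split => //.
  rewrite -subr_gt0; near: t; apply: (cvgr_gt _ (cvg_at_right_filter cj)).
  by rewrite subr_gt0.
rewrite addrC; near: t.
exact: (cvgr_lt _ (cvg_at_right_filter cb)).
Unshelve. all: by end_near. Qed.

(** One half is the definition of the infimum; the other is [cdf_lt_le] against every competing
    bound. *)
Lemma limit_cdf_sandwich : sandwich p (limit_cdf p).
Proof.
move=> N j t N0; split; last exact: limit_cdf_le.
move=> jt; rewrite -lerBlDr; apply: le_limit_cdf => K i K0 ti.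
by rewrite lerBlDr addrAC; exact: cdf_lt_le.
Qed.

End limit_cdf.

(** * Binomial distributions *)

Section binomial_probability.
Context {R : realType}.
Implicit Types (r : R) (phi : nat -> R).

(** [binom_weight] with real and natural arguments, as [dd_cone] requires; it vanishes for [k > N]
    with the binomial coefficient. *)
Definition binomial_weight r N k : R := 'C(N, k)%:R * r ^+ k * (1 - r) ^+ (N - k).

Lemma binomial_weight_ge0 r N k : 0 <= r <= 1 -> 0 <= binomial_weight r N k.
Proof. by move=> /andP[r0 r1]; rewrite !mulr_ge0// exprn_ge0// subr_ge0. Qed.

Lemma binomial_weight_sum1 r N : \sum_(k < N.+1) binomial_weight r N k = 1.
Proof.
transitivity ((1 - r + r) ^+ N); last by rewrite subrK expr1n.
rewrite exprDn; apply: eq_bigr => k _.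
by rewrite /binomial_weight -mulrA mulr_natl (mulrC (_ ^+ k)).
Qed.

Lemma binomial_weight_small r N k : (N < k)%N -> binomial_weight r N k = 0.
Proof. by move=> Nk; rewrite /binomial_weight bin_small// !mul0r. Qed.

Lemma binomial_weight_cone r : 0 <= r <= 1 -> dd_cone (binomial_weight r).
Proof.
move=> r01; split.
- by move=> *; exact: binomial_weight_ge0.
- exact: binomial_weight_sum1.
move=> K k kK; rewrite /binomial_weight.
have e1 : k.+1%:R * 'C(K.+1, k.+1)%:R = K.+1%:R * 'C(K, k)%:R :> R.
  by rewrite -!natrM mul_bin_diag.
have e2 : (K.+1%:R - k%:R) * 'C(K.+1, k)%:R = K.+1%:R * 'C(K, k)%:R :> R.
  by rewrite -natrB ?(leqW kK)// -!natrM mul_bin_down.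
rewrite !mulrA e1 e2 subSS (subSn kK) !exprS.
have S0 : (K.+1%:R : R) != 0 by rewrite pnatr_eq0.
apply: (mulIf S0); rewrite divfK//; ring.
Qed.

Lemma binomial_weight_pascal r N k :
  binomial_weight r N.+1 k.+1 =
  r * binomial_weight r N k + (1 - r) * binomial_weight r N k.+1.
Proof.
rewrite /binomial_weight binS natrD subSS exprS.
have [kN|Nk] := ltnP k N; last by rewrite bin_small ?ltnS//; ring.
by rewrite -(subnSK kN) exprS; ring.
Qed.

(** Conditioning on one of the [N.+1] trials: a success shifts the argument of [phi]. *)
Lemma binomial_weight_meanS r N phi :
  mean (binomial_weight r) N.+1 phi =
  r * mean (binomial_weight r) N (phi \o S) + (1 - r) * mean (binomial_weight r) N phi.
Proof.
rewrite /mean big_ord_recl/= [in X in _ * X]/=.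
under eq_bigr do rewrite /bump/= add1n binomial_weight_pascal mulrDl
  -(mulrA r) -(mulrA (1 - r)).
rewrite big_split/= -!mulr_sumr addrCA; congr (_ + _).
rewrite [X in _ + _ * X]big_ord_recr/= (binomial_weight_small r (ltnSn N)) mul0r addr0.
rewrite [X in _ = _ * X]big_ord_recl/= mulrDr; congr (_ + _).
by rewrite /binomial_weight !bin0 !subn0 !expr0 exprS; ring.
Qed.

(** The centre [a] is arbitrary so that the induction can absorb the shift by one trial into
    [a - 1]. *)
Lemma binomial_weight_sqr r N (a : R) :
  mean (binomial_weight r) N (fun k => (k%:R - a) ^+ 2) =
  (N%:R * r - a) ^+ 2 + N%:R * r * (1 - r).
Proof.
elim: N a => [|N IH] a.
  by rewrite /mean big_ord1 /binomial_weight/= bin0 !expr0; ring.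
rewrite binomial_weight_meanS IH.
have -> : mean (binomial_weight r) N ((fun k => (k%:R - a) ^+ 2) \o S) =
    mean (binomial_weight r) N (fun k => (k%:R - (a - 1)) ^+ 2).
  by apply: eq_bigr => k _ /=; rewrite -natr1; congr (_ * _ ^+ 2); ring.
by rewrite IH -natr1; ring.
Qed.

Lemma binomial_weight_variance r N : 0 <= r <= 1 ->
  mean (binomial_weight r) N (fun k => (k%:R - r * N%:R) ^+ 2) <= N%:R.
Proof.
move=> /andP[r0 r1]; rewrite binomial_weight_sqr (mulrC r) subrr expr0n/= add0r.
by rewrite -mulrA ler_piMr// mulr_ile1//; lra.
Qed.

(** Chebyshev around [r]: the step function is the distribution function of the point mass at [r],
    so integrating over [r] will give that of a measure. *)
Lemma binomial_weight_sandwich r : 0 <= r <= 1 ->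
  sandwich (binomial_weight r) (fun t => (r <= t)%R%:R).
Proof.
move=> r01 N j t N0; have cb := binomial_weight_cone r01.
have N0r : 0 < N%:R :> R by rewrite ltr0n.
have V y : mean (binomial_weight r) N
    (fun k => (y ^+ 2)^-1 * (k%:R - r * N%:R) ^+ 2) <= N%:R / y ^+ 2.
  rewrite meanZ mulrC ler_wpM2r ?invr_ge0 ?sqr_ge0//.
  exact: binomial_weight_variance.
split=> [jt|tj]; have [rt|tr] := lerP r t.
- by rewrite (le_trans (cdf_lt_le1 _ _ cb))// lerDl dev_bound_ge0.
- have rN : t * N%:R <= r * N%:R by rewrite ler_pM2r// ltW.
  rewrite add0r /dev_bound -sqrrN opprB; apply: le_trans (V _).
  apply: le_mean => // k _; case: ltnP => [kj|_]; last first.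
    by rewrite mulr_ge0 ?invr_ge0 ?sqr_ge0.
  rewrite mulrC -[(_ - r * _) ^+ 2]sqrrN opprB; apply: sqr_ratio_ge1; first lra.
  have : k%:R <= j%:R :> R by rewrite ler_nat ltnW.
  lra.
- have rN : r * N%:R <= t * N%:R by rewrite ler_pM2r.
  rewrite -lerBlDr; apply: (@le_trans _ _ (1 - mean (binomial_weight r) N
    (fun k => ((j%:R - t * N%:R) ^+ 2)^-1 * (k%:R - r * N%:R) ^+ 2))).
    by rewrite lerD2l lerN2 /dev_bound; exact: V.
  rewrite -[X in X - _](mean_cst N 1 cb) -meanN -meanD; apply: le_mean => // k _.
  case: ltnP => [_|jk].
    by rewrite lerBlDr lerDl mulr_ge0 ?invr_ge0 ?sqr_ge0.
  rewrite subr_le0 mulrC; apply: sqr_ratio_ge1; first lra.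
  have : j%:R <= k%:R :> R by rewrite ler_nat.
  lra.
- by rewrite addr_ge0 ?cdf_lt_ge0 ?dev_bound_ge0.
Qed.

End binomial_probability.

(** * Channels into multisets *)

Section measures_on_multisets.
Context {R : realType}.

Lemma multiset2_of_eq K (psi : multiset2 K) (k : 'I_K.+1) :
  (psi ord0 = k :> nat) -> psi = multiset2_of k.
Proof.
move=> psik; apply/val_inj/ffunP => x /=; rewrite ffunE.
have := mult_size psi; rewrite big_ord_recl big_ord1 => /eqP psiE.
case: ifPn => [/eqP -> //|x0].
have -> : x = lift ord0 ord0 by apply/val_inj; case: x x0 => -[|[|]].
by rewrite -[X in (X - _)%N]psiE psik addKn.
Qed.

Lemma multiset2_ofK K (k : 'I_K.+1) : multiset2_of k ord0 = k :> nat.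
Proof. by rewrite /= ffunE. Qed.

Lemma multiset2_of_inj K : injective (@multiset2_of K).
Proof. by move=> i j ij; apply/ord_inj; rewrite -multiset2_ofK ij multiset2_ofK. Qed.

Lemma multiset2_of_surj K (psi : multiset2 K) : exists k, psi = multiset2_of k.
Proof.
have psiK : (psi ord0 < K.+1)%N.
  by rewrite ltnS -[X in (_ <= X)%N](eqP (mult_size psi)) big_ord_recl leq_addr.
by exists (Ordinal psiK); exact: multiset2_of_eq.
Qed.

Local Open Scope ereal_scope.

Lemma integral_multiset2 K (mu : {measure set (multiset2 K) -> \bar R})
    (f : multiset2 K -> \bar R) : (forall psi, 0 <= f psi) ->
  \int[mu]_psi f psi = \sum_(k < K.+1) f (multiset2_of k) * mu [set multiset2_of k].
Proof.
move=> f0.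
have fE psi : f psi = \sum_(k < K.+1)
    f (multiset2_of k) * (\1_[set multiset2_of k] psi)%:E.
  have [k ->] := multiset2_of_surj psi.
  rewrite (bigD1 k)//= indicE mem_set// mule1 big1 ?adde0// => i ik.
  rewrite indicE memNset ?mule0//= => /multiset2_of_inj ki.
  by rewrite ki eqxx in ik.
under eq_integral do rewrite fE.
rewrite ge0_integral_sum//; last first.
  by move=> k psi _; rewrite mule_ge0// lee_fin.
apply: eq_bigr => k _; rewrite ge0_integralZl//.
by rewrite integral_indic// setIT.
Qed.

Lemma probability_multiset2_eq K (mu nu : probability (multiset2 K) R) :
  (forall k, mu [set multiset2_of k] = nu [set multiset2_of k]) ->
  forall U, mu U = nu U.
Proof.
move=> mn U; rewrite -(setIT U) -!integral_indic//.
by rewrite !integral_multiset2//; apply: eq_bigr => k _; congr (_ * _); exact: mn.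
Qed.

Lemma binomE K (r : unit_interval R) (k : 'I_K.+1) :
  channel_at (binom R K) r [set multiset2_of k] =
  (binomial_weight (unit_interval_val r) K k)%:E.
Proof.
rewrite /channel_at/= /convex_sum (bigD1 k)//= diracE mem_set// mule1.
rewrite big1 ?adde0// => i ik; rewrite diracE memNset ?mule0//= => /multiset2_of_inj ki.
by rewrite ki eqxx in ik.
Qed.

Lemma multiset2_del0 K (k : 'I_K.+1) :
  multiset2_del (multiset2_of (lift ord0 k)) ord0 = multiset2_of k.
Proof.
apply: multiset2_of_eq; rewrite multiset2_delE multiset2_ofK//=.
by rewrite /bump/= add1n subn1.
Qed.

Lemma multiset2_del1 K (k : 'I_K.+1) :
  multiset2_del (multiset2_of (widen_ord (leqnSn _) k)) (lift ord0 ord0) = multiset2_of k.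
Proof.
apply: multiset2_of_eq; rewrite multiset2_delE ?multiset2_ofK/= ?subn0//.
by rewrite ffunE/= subn_gt0.
Qed.

(** Only two multisets can lead to [k] zeros: [k + 1] zeros with a zero drawn, or [k] zeros with a
    one drawn. The Dirac form is ready to be integrated in [psi]. *)
Lemma draw_deleteE K (psi : multiset2 K.+1) (k : 'I_K.+1) :
  channel_at (draw_delete R K) psi [set multiset2_of k] =
  (k.+1%:R / K.+1%:R)%:E * \d_psi [set multiset2_of (lift ord0 k)] +
  ((K.+1%:R - k%:R) / K.+1%:R)%:E *
    \d_psi [set multiset2_of (widen_ord (leqnSn _) k)].
Proof.
rewrite /channel_at/= /convex_sum big_ord_recl big_ord1.
have [l ->] := multiset2_of_surj psi; congr (_ + _).
- have [->|lk] := eqVneq l (lift ord0 k).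
    rewrite multiset2_del0 !diracE !mem_set// /dd_weight multiset2_ofK.
    by rewrite /= /bump/= add1n.
  rewrite [in RHS]diracE memNset ?mule0; last first.
    by move=> /= /multiset2_of_inj /eqP; rewrite (negPf lk).
  (* Without a zero to delete, [multiset2_del] returns its default value, which may be the target;
     the weight 0 removes this term. *)
  have [l0|l0] := posnP l.
    by rewrite /dd_weight multiset2_ofK l0 mul0r mul0e.
  rewrite diracE memNset ?mule0//= => /(congr1 (fun m : multiset2 K => m ord0)).
  rewrite multiset2_delE multiset2_ofK// multiset2_ofK/= => lkE.
  move/eqP: lk; apply; apply/val_inj; rewrite /= /bump/= -lkE.
  by rewrite subn1 add1n prednK.
- have mult1 : multiset2_of l (lift ord0 ord0) = (K.+1 - l)%N by rewrite /= ffunE.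
  have [->|lk] := eqVneq l (widen_ord (leqnSn _) k).
    rewrite multiset2_del1 !diracE !mem_set// /dd_weight /= ffunE/=.
    by rewrite natrB// ltnW// ltnS ltnW.
  rewrite [in RHS]diracE memNset ?mule0; last first.
    by move=> /= /multiset2_of_inj /eqP; rewrite (negPf lk).
  have [l0|l0] := posnP (K.+1 - l)%N.
    by rewrite /dd_weight mult1 l0 mul0r mul0e.
  rewrite diracE memNset ?mule0//= => /(congr1 (fun m : multiset2 K => m ord0)).
  rewrite multiset2_delE ?mult1// !multiset2_ofK/= subn0 => lkE.
  by move/eqP: lk; apply; apply/val_inj.
Qed.

Lemma kleisli_draw_deleteE d (Y : measurableType d) K
    (c : channel Y (multiset2 K.+1) R) y (k : 'I_K.+1) :
  channel_at (kleisli_comp (draw_delete R K) c) y [set multiset2_of k] =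
  (k.+1%:R / K.+1%:R)%:E * channel_at c y [set multiset2_of (lift ord0 k)] +
  ((K.+1%:R - k%:R) / K.+1%:R)%:E *
    channel_at c y [set multiset2_of (widen_ord (leqnSn _) k)].
Proof.
have w0 (a b : R) : (0 <= a)%R -> (0 <= b)%R -> 0 <= (a / b)%:E.
  by move=> a0 b0; rewrite lee_fin divr_ge0.
have kK : (0 <= K.+1%:R - k%:R :> R)%R by rewrite subr_ge0 ler_nat ltnW.
rewrite /channel_at/= /kleisli_measure.
under eq_integral do rewrite draw_deleteE.
rewrite ge0_integralD//; try by move=> *; rewrite mule_ge0 ?w0.
rewrite !ge0_integralZl ?w0//.
have dE (U : set (multiset2 K.+1)) : \int[c y]_psi \d_psi U = c y U.
  by rewrite -[in RHS](setIT U) -integral_indic.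
by rewrite !dE.
Qed.

End measures_on_multisets.

(** * Coherent sequences from distributions on multisets *)

Section cones_of_channels.
Context {R : realType}.

(** Beyond [K], [inord] falls back to [ord0], which preserves the nonnegativity that [dd_cone]
    demands for all [k]. *)
Definition multiset2_weight (nu : forall K, probability (multiset2 K) R) K k : R :=
  fine (nu K [set multiset2_of (inord k)]).

Lemma multiset2_weightE nu K (k : 'I_K.+1) :
  (multiset2_weight nu K k)%:E = nu K [set multiset2_of k].
Proof. by rewrite /multiset2_weight inord_val fineK// fin_num_measure. Qed.

Lemma dd_cone_multiset2_weight (nu : forall K, probability (multiset2 K) R) :
  (forall K (k : 'I_K.+1), nu K [set multiset2_of k] =
    (k.+1%:R / K.+1%:R)%:E * nu K.+1 [set multiset2_of (lift ord0 k)] +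
    ((K.+1%:R - k%:R) / K.+1%:R)%:E *
      nu K.+1 [set multiset2_of (widen_ord (leqnSn _) k)])%E ->
  dd_cone (multiset2_weight nu).
Proof.
move=> ddnu; split.
- by move=> K k; apply: fine_ge0.
- move=> K; apply: EFin_inj; rewrite -sumEFin.
  under eq_bigr do rewrite multiset2_weightE.
  rewrite -(probability_setT (nu K)) -[in RHS](setIT setT) -integral_indic//.
  rewrite integral_multiset2//; apply: eq_bigr => k _.
  by rewrite indicE in_setT mul1e.
- move=> K k kK; apply: EFin_inj.
  have := ddnu K (Ordinal (kK : k < K.+1)%N); rewrite -!multiset2_weightE/=.
  rewrite /bump add1n => ->; rewrite -!EFinM -EFinD; congr (_%:E).
  by field; rewrite nat1r.
Qed.

End cones_of_channels.

(** * Measures on the unit interval *)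

Section unit_interval_measures.
Context {R : realType}.

Definition unit_interval_ray (t : R) : set (unit_interval R) :=
  [set r | unit_interval_val r <= t].

Lemma measurable_unit_interval_ray t : measurable (unit_interval_ray t).
Proof.
rewrite -[X in measurable X]setTI.
have -> : unit_interval_ray t = @unit_interval_val R @^-1` `]-oo, t].
  by apply/seteqP; split => r /=; rewrite in_itv.
exact: measurable_unit_interval_val.
Qed.

(** Open sets of the subspace are preimages of open sets of the line, and the generators []x, +oo[]
    pull back to complements of rays. *)
Lemma unit_interval_measurableE :
  @measurable _ (unit_interval R) = <<s range unit_interval_ray >>.
Proof.
apply/seteqP; split; last first.
  apply: smallest_sub; first exact: sigma_algebra_measurable.
  by move=> _ [t _ <-]; exact: measurable_unit_interval_ray.
apply: smallest_sub; first exact: smallest_sigma_algebra.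
move=> _ [V oV <-].
have : preimage_set_system setT (@unit_interval_val R)
    ((@RGenOInfty.G R).-sigma.-measurable) (@unit_interval_val R @^-1` V).
  exists V; last by rewrite setTI.
  by rewrite -RGenOInfty.measurableE; exact: open_measurable.
rewrite -g_sigma_preimageE; apply: smallest_sub; first exact: smallest_sigma_algebra.
move=> _ [_ [x ->] <-]; rewrite setTI.
have -> : @unit_interval_val R @^-1` `]x, +oo[ = setT `\` unit_interval_ray x.
  apply/seteqP; split => r /=; rewrite /unit_interval_ray /= in_itv/= andbT ltNge.
    by move/negP.
  by move=> [_ /negP].
have [_ + _] := @smallest_sigma_algebra _ setT (range unit_interval_ray); apply.
by apply: sub_sigma_algebra; exists x.
Qed.

Lemma unit_interval_ray_setI : setI_closed (range unit_interval_ray).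
Proof.
move=> _ _ [s _ <-] [t _ <-]; exists (Num.min s t) => //.
by apply/seteqP; split => r /=; rewrite /unit_interval_ray /= le_min => /andP.
Qed.

Lemma unit_interval_ray_full t : 1 <= t -> unit_interval_ray t = setT.
Proof.
move=> t1; apply/seteqP; split => // r _.
by have /andP[_ r1] := unit_interval_itv r; exact: le_trans t1.
Qed.

Lemma unit_interval_ray_empty t : t < 0 -> unit_interval_ray t = set0.
Proof.
move=> t0; apply/seteqP; split => // r /= rt.
have /andP[r0 _] := unit_interval_itv r.
by have := lt_le_trans t0 (le_trans r0 rt); rewrite ltxx.
Qed.

Lemma unit_interval_measure_unique
    (mu nu : {finite_measure set (unit_interval R) -> \bar R}) :
  (forall t, mu (unit_interval_ray t) = nu (unit_interval_ray t)) ->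
  forall U, measurable U -> mu U = nu U.
Proof.
move=> mn; apply: (measure_unique (range unit_interval_ray) (fun=> unit_interval_ray 1)).
- exact: unit_interval_measurableE.
- exact: unit_interval_ray_setI.
- by move=> _; exists 1.
- by rewrite unit_interval_ray_full// bigcup_const//; exists 0%N.
- by move=> _ [t _ <-]; exact: mn.
- move=> _; rewrite -ge0_fin_numE// fin_num_measure//.
  exact: measurable_unit_interval_ray.
Qed.

(** Continuity from above along [s + 1/(n + 1)]. It turns the comparisons of [sandwich_le], which
    require [s < t], into comparisons at [s]. *)
Lemma unit_interval_measure_rc (mu : {finite_measure set (unit_interval R) -> \bar R})
    (a : \bar R) (s : R) :
  (forall t, (s < t)%R -> a <= mu (unit_interval_ray t))%E ->
  (a <= mu (unit_interval_ray s))%E.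
Proof.
move=> h.
have cap : \bigcap_n unit_interval_ray (s + n.+1%:R^-1) = unit_interval_ray s.
  apply/seteqP; split => r /=.
    move=> rs; rewrite /unit_interval_ray/=; apply/ler_addgt0Pr => e e0.
    have := rs (Num.truncn e^-1) I; rewrite /unit_interval_ray/= => /le_trans; apply.
    by rewrite lerD2l invf_ple ?posrE// ltW// truncnS_gt.
  move=> rs n _; rewrite /unit_interval_ray/= (le_trans rs)// lerDl.
  by rewrite invr_ge0.
have cv : mu (unit_interval_ray (s + n.+1%:R^-1)) @[n --> \oo] -->
    mu (unit_interval_ray s).
  rewrite -cap; apply: nonincreasing_cvg_mu.
  - rewrite -ge0_fin_numE// fin_num_measure//; exact: measurable_unit_interval_ray.
  - by move=> n; exact: measurable_unit_interval_ray.
  - by rewrite cap; exact: measurable_unit_interval_ray.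
  - move=> m n mn; apply/subsetPset => r /=; rewrite /unit_interval_ray/=.
    by move=> /le_trans; apply; rewrite lerD2l lef_pV2 ?posrE// ler_nat.
have := cvg_lim (@ereal_hausdorff R) cv => <-.
apply: lime_ge; first by apply/cvg_ex; eexists; exact: cv.
by apply: nearW => n; apply: h; rewrite ltrDl invr_gt0.
Qed.

Section binomial_moments.
Context (mu : probability (unit_interval R) R).

Definition binomial_moment N k : R :=
  \int[mu]_r binomial_weight (unit_interval_val r) N k.

Lemma integrable_binomial_weight N k : mu.-integrable setT
  (EFin \o (fun r => binomial_weight (unit_interval_val r) N k)).
Proof.
apply: measurable_bounded_integrable => //.
- by rewrite -ge0_fin_numE// fin_num_measure.
- have mr := @measurable_unit_interval_val R.
  apply: measurable_funM; last by apply: measurable_funX; exact: measurable_funB.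
  by apply: measurable_funM => //; exact: measurable_funX.
exists 'C(N, k)%:R; split; first exact: num_real.
move=> y Cy r _ /=; have r01 := unit_interval_itv r.
rewrite ger0_norm ?binomial_weight_ge0//; apply: le_trans (ltW Cy).
have /andP[r0 r1] := r01.
rewrite /binomial_weight -mulrA ler_piMr// mulr_ile1// ?exprn_ge0 ?subr_ge0//.
  exact: exprn_ile1.
by apply: exprn_ile1; rewrite ?subr_ge0// gerBl.
Qed.

Lemma integrable_mean N phi : mu.-integrable setT
  (EFin \o (fun r => mean (binomial_weight (unit_interval_val r)) N phi)).
Proof.
have -> : EFin \o (fun r => mean (binomial_weight (unit_interval_val r)) N phi) =
    (fun r => \sum_(k < N.+1)
      (phi k)%:E * (binomial_weight (unit_interval_val r) N k)%:E)%E.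
  apply/funext => r /=; rewrite /mean -sumEFin; apply: eq_bigr => k _.
  by rewrite mulrC.
apply: integrable_sum => // k _; apply: integrableZl => //.
exact: integrable_binomial_weight.
Qed.

Lemma mean_binomial_moment N phi :
  mean binomial_moment N phi =
  \int[mu]_r mean (binomial_weight (unit_interval_val r)) N phi.
Proof.
rewrite /Rintegral; under eq_integral do rewrite /mean -sumEFin.
rewrite integral_sum//=; last first.
  move=> k; under eq_fun do rewrite mulrC EFinM.
  by apply: integrableZl => //; exact: integrable_binomial_weight.
rewrite -sum_fine; last first.
  move=> k _; apply: integrable_fin_num => //=.
  under eq_fun do rewrite mulrC EFinM.
  by apply: integrableZl => //; exact: integrable_binomial_weight.
apply: eq_bigr => k _; rewrite /binomial_moment -RintegralZr//.
exact: integrable_binomial_weight.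
Qed.

Lemma dd_cone_binomial_moment : dd_cone binomial_moment.
Proof.
have one : \int[mu]_r (1 : R) = 1.
  have := Rintegral_cst mu measurableT 1; rewrite mul1r => ->.
  exact: (congr1 fine (probability_setT mu)).
split.
- by move=> N k; apply: Rintegral_ge0 => r _; exact/binomial_weight_ge0/unit_interval_itv.
- move=> N; have := mean_binomial_moment N (fun=> 1).
  rewrite {1}/mean; under eq_bigr do rewrite mulr1.
  move=> ->; rewrite -[RHS]one; apply: eq_Rintegral => r _.
  exact/mean_cst/binomial_weight_cone/unit_interval_itv.
- move=> K k kK; rewrite /binomial_moment.
  have -> : \int[mu]_r binomial_weight (unit_interval_val r) K k =
      \int[mu]_r (k.+1%:R / K.+1%:R * binomial_weight (unit_interval_val r) K.+1 k.+1 +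
        (K.+1%:R - k%:R) / K.+1%:R * binomial_weight (unit_interval_val r) K.+1 k).
    apply: eq_Rintegral => r _.
    rewrite (dd_coneE (binomial_weight_cone (unit_interval_itv r)) kK).
    by field; rewrite nat1r.
  rewrite RintegralD//; try by
    apply: (@integrableZl _ _ _ _ _ _ _ (EFin \o _)) => //;
    exact: integrable_binomial_weight.
  rewrite !RintegralZl//; try exact: integrable_binomial_weight.
  by field; rewrite nat1r.
Qed.

(** Integration of [binomial_weight_sandwich] over [r], the deviation term being constant in [r]. *)
Lemma binomial_moment_sandwich :
  sandwich binomial_moment (fun t => fine (mu (unit_interval_ray t))).
Proof.
have mray t := measurable_unit_interval_ray t.
have rayE t : EFin \o (fun r => (unit_interval_val r <= t)%R%:R) =
    EFin \o \1_(unit_interval_ray t) :> (unit_interval R -> \bar R).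
  apply/funext => r /=; rewrite indicE; congr (nat_of_bool _)%:R%:E.
  by apply/idP/idP => [/mem_set|/set_mem].
have iray t : mu.-integrable setT
    (EFin \o (fun r => (unit_interval_val r <= t)%R%:R)).
  by rewrite rayE; apply: integrable_indic => //; rewrite ltey_eq fin_num_measure.
have Eray t : \int[mu]_r (unit_interval_val r <= t)%R%:R =
    fine (mu (unit_interval_ray t)).
  rewrite /Rintegral -[X in integral _ _ X]/(EFin \o _) rayE.
  by rewrite integral_indic// setIT.
have cst (a : R) : mu.-integrable setT (EFin \o cst a).
  exact: finite_measure_integrable_cst.
have Ecst (a : R) : \int[mu]_r a = a.
  rewrite (Rintegral_cst mu measurableT a) -[RHS]mulr1; congr (_ * _).
  exact: (congr1 fine (probability_setT mu)).
have RintegralDcst f a : mu.-integrable setT (EFin \o f) ->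
    \int[mu]_r (f r + a) = \int[mu]_r f r + a.
  by move=> intf; rewrite RintegralD ?Ecst//; exact: (cst a).
have integrableDcst f a : mu.-integrable setT (EFin \o f) ->
    mu.-integrable setT (EFin \o (fun r => f r + a)).
  by move=> intf; exact: (integrableD measurableT intf (cst a)).
move=> N j t N0; split => jt; rewrite /cdf_lt mean_binomial_moment -Eray.
- rewrite -RintegralDcst//; apply: le_Rintegral => //.
  + exact: integrable_mean.
  + exact: integrableDcst.
  + by move=> r _; apply: (binomial_weight_sandwich (unit_interval_itv r) _ _ N0).1.
- rewrite -RintegralDcst; last exact: integrable_mean.
  apply: le_Rintegral => //.
  + by apply: integrableDcst; exact: integrable_mean.
  + by move=> r _; apply: (binomial_weight_sandwich (unit_interval_itv r) _ _ N0).2.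
Qed.

End binomial_moments.
End unit_interval_measures.

(** * Retraction of the line onto the unit interval *)

Section clamp.
Context {R : realType}.

Lemma clamp_subproof (x : R) : Num.max 0 (Num.min x 1) \in (`[0%R, 1%R]%classic : set R).
Proof.
apply/mem_set; rewrite /= in_itv/= le_max lexx /= ge_max ler01/=.
by rewrite ge_min lexx orbT.
Qed.

Definition clamp (x : measurableTypeR R) : unit_interval R := SigSub (clamp_subproof x).

(** Outside this range of [t] the ray is empty or full, and so is its preimage. *)
Lemma preimage_clamp_ray t : 0 <= t < 1 ->
  clamp @^-1` unit_interval_ray t = `]-oo, t]%classic.
Proof.
move=> /andP[t0 t1]; apply/seteqP; split => x /=;
  rewrite /unit_interval_ray/= /unit_interval_val/= in_itv/= ge_max t0/= ge_min;
  by rewrite [1 <= t]leNgt t1 orbF.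
Qed.

Lemma measurable_clamp : measurable_fun setT clamp.
Proof.
apply: (measurability _ unit_interval_measurableE) => _ [_ [t _ <-] <-]; rewrite setTI.
have [t0|t0] := ltP t 0; first by rewrite unit_interval_ray_empty// preimage_set0.
have [t1|t1] := leP 1 t; first by rewrite unit_interval_ray_full// preimage_setT.
by rewrite preimage_clamp_ray ?t0//; exact: measurable_itv.
Qed.

HB.instance Definition _ := isMeasurableFun.Build _ _ _ _ clamp measurable_clamp.

End clamp.

(** * The measure that represents a coherent sequence *)

Section limit_measure.
Context {R : realType} (p : nat -> nat -> R) (cp : dd_cone p).

Let limit_cdfNy : limit_cdf p @ -oo --> (0 : R).
Proof.
apply: cvg_near_cst; near=> t; apply: (limit_cdf_lt0 cp).
near: t; exact: nbhs_ninfty_lt.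
Unshelve. all: by end_near. Qed.

Let limit_cdfy : limit_cdf p @ +oo --> (1 : R).
Proof.
apply: cvg_near_cst; near=> t; apply: (limit_cdf_ge1 cp).
near: t; exact: nbhs_pinfty_ge.
Unshelve. all: by end_near. Qed.

#[local] HB.instance Definition _ :=
  isCumulative.Build R _ R (limit_cdf p) (limit_cdf_nd cp) (limit_cdf_rc cp).
#[local] HB.instance Definition _ :=
  isCumulativeBounded.Build R 0 1 (limit_cdf p) limit_cdfNy limit_cdfy.

(** [limit_cdf] is 0 before 0 and 1 from 1 on, so its Stieltjes measure lives on the interval and
    [clamp] only changes the carrier. *)
Definition limit_measure : probability (unit_interval R) R :=
  distribution (lebesgue_stieltjes_measure (limit_cdf p)) clamp.

Lemma limit_measure_ray t : limit_measure (unit_interval_ray t) = (limit_cdf p t)%:E.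
Proof.
have [t0|t0] := ltP t 0.
  by rewrite unit_interval_ray_empty// measure0 limit_cdf_lt0.
have [t1|t1] := leP 1 t.
  by rewrite unit_interval_ray_full// probability_setT limit_cdf_ge1.
rewrite -(cdf_lebesgue_stieltjes_id (limit_cdf p)) /cdf /limit_measure.
have /preimage_clamp_ray rayE : 0 <= t < 1 by rewrite t0.
exact: (congr1 (lebesgue_stieltjes_measure (limit_cdf p)) rayE).
Qed.

Lemma binomial_moment_limit n k : (k <= n)%N ->
  binomial_moment limit_measure n k = p n k.
Proof.
apply: (@sandwich_unique _ _ _ (limit_cdf p)) => //.
- exact: dd_cone_binomial_moment.
- have -> : limit_cdf p = (fun t => fine (limit_measure (unit_interval_ray t))).
    by apply/funext => t; rewrite limit_measure_ray.
  exact: binomial_moment_sandwich.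
- exact: limit_cdf_sandwich.
Qed.

End limit_measure.

(** * Measurable dependence on a parameter *)

Section measurability.
Context {R : realType} d (Y : measurableType d).

(** An infimum is below [a] exactly when some admissible bound is, so the sublevel set is a
    countable union over [N] and [j]; inadmissible pairs contribute the empty set. *)
Lemma measurable_limit_cdf (p : Y -> nat -> nat -> R) t :
  (forall y, dd_cone (p y)) ->
  (forall K k, (k <= K)%N -> measurable_fun setT (fun y => p y K k)) ->
  measurable_fun setT (fun y => limit_cdf (p y) t).
Proof.
move=> cp mp; apply: (measurability _ (RGenInftyO.measurableE R)) => _ [_ [a ->] <-].
have mcdf N j : measurable_fun setT (fun y => cdf_lt (p y) N j).
  rewrite /cdf_lt /mean; apply: measurable_sum => k.
  by apply: measurable_funM => //; apply: mp; rewrite -ltnS.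
have -> : setT `&` (fun y => limit_cdf (p y) t) @^-1` `]-oo, a[ =
    \bigcup_N \bigcup_j (if (0 < N)%N && (t * N%:R < j%:R) then
      setT `&` (fun y => cdf_lt (p y) N j) @^-1` `]-oo, (a - dev_bound N j t)[ else set0).
  rewrite setTI; apply/seteqP; split => y /=; rewrite in_itv/=.
    move=> /(limit_cdf_lt (cp y)) [N [j [N0 tj h]]].
    exists N => //; exists j => //; rewrite N0 tj/=; split => //.
    by rewrite in_itv/= ltrBrDr.
  move=> [N _ [j _]]; case: ifPn => [/andP[N0 tj] [_ /=]|_ []].
  rewrite in_itv/= ltrBrDr => h; apply/(limit_cdf_lt (cp y)).
  by exists N, j.
apply: bigcupT_measurable => N; apply: bigcupT_measurable => j.
by case: ifPn => // _; exact: mcdf.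
Qed.

(** Dynkin's lemma, for the rays are closed under intersection and generate the sigma-algebra. *)
Lemma measurable_unit_interval_probability (mu : Y -> probability (unit_interval R) R) :
  (forall t, measurable_fun setT (fun y => mu y (unit_interval_ray t))) ->
  forall U, measurable U -> measurable_fun setT (fun y => mu y U).
Proof.
move=> mray U; rewrite unit_interval_measurableE => mU.
apply: (dynkin_induction unit_interval_measurableE unit_interval_ray_setI
  (P := fun U => measurable_fun setT (fun y => mu y U))) mU.
- have -> : (fun y => mu y setT) = cst 1%E by apply/funext => y; exact: probability_setT.
  exact: measurable_cst.
- by move=> _ [t _ <-]; exact: mray.
- move=> S mS mfS; have -> : (fun y => mu y (~` S)) = (fun y => 1 - mu y S)%E.
    by apply/funext => y; exact: probability_setC.
  exact: emeasurable_funB.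
- move=> F mF tF mfF.
  have -> : (fun y => mu y (\bigcup_k F k)) = (fun y => \sum_(0 <= k <oo) mu y (F k))%E.
    by apply/funext => y; rewrite measure_bigcup//; apply: eq_eseriesl => k;
      rewrite in_setT.
  by apply: ge0_emeasurable_sum => // k y _ _.
Qed.

End measurability.

(** * Uniqueness of the measure and the limit property *)

Section existence_uniqueness.
Context {R : realType}.

(** The distribution functions of [mu] and [nu] sandwich the same sequence, so [sandwich_le]
    interleaves them in both directions and right-continuity closes the gap. *)
Lemma binomial_moment_unique (mu nu : probability (unit_interval R) R) :
  (forall n k, (k <= n)%N -> binomial_moment mu n k = binomial_moment nu n k) ->
  forall U, measurable U -> mu U = nu U.
Proof.
move=> mn; apply: unit_interval_measure_unique => s.
have fin (m : probability (unit_interval R) R) t : m (unit_interval_ray t) \is a fin_num.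
  by rewrite fin_num_measure//; exact: measurable_unit_interval_ray.
have [s0|s0] := ltP s 0; first by rewrite unit_interval_ray_empty// !measure0.
have swap : sandwich (binomial_moment mu) (fun t => fine (nu (unit_interval_ray t))).
  move=> N j t N0; have := binomial_moment_sandwich nu j t N0.
  have -> // : cdf_lt (binomial_moment nu) N j = cdf_lt (binomial_moment mu) N j.
  by apply: eq_bigr => k _; rewrite mn// -ltnS.
have h := @binomial_moment_sandwich _ mu.
have le (m m' : probability (unit_interval R) R) t :
    fine (m (unit_interval_ray s)) <= fine (m' (unit_interval_ray t)) ->
    (m (unit_interval_ray s) <= m' (unit_interval_ray t))%E.
  by move=> mm; rewrite -(fineK (fin m s)) -(fineK (fin m' t)) lee_fin.
apply/le_anti/andP; split; apply: unit_interval_measure_rc => t st; apply: le.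
- exact: (sandwich_le h swap s0 st).
- exact: (sandwich_le swap h s0 st).
Qed.

Lemma kleisli_binomE d (Y : measurableType d) K (c : channel Y (unit_interval R) R) y
    (k : 'I_K.+1) :
  channel_at (kleisli_comp (binom R K) c) y [set multiset2_of k] =
  (binomial_moment (channel_at c y) K k)%:E.
Proof.
rewrite /binomial_moment /Rintegral fineK; last first.
  by apply: integrable_fin_num => //; exact: integrable_binomial_weight.
by apply: eq_integral => r _; exact: binomE.
Qed.

End existence_uniqueness.

Theorem theorem8 (R : realType) :
  (forall K : nat,
     channel_eq (kleisli_comp (draw_delete R K) (binom R K.+1)) (binom R K)) /\
  (forall (d : measure_display) (Y : measurableType d)
     (c : forall K : nat, channel Y (multiset2 K) R),
     (forall K : nat,
        channel_eq (kleisli_comp (draw_delete R K) (c K.+1)) (c K)) ->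
     exists c0 : channel Y (unit_interval R) R,
       (forall K : nat, channel_eq (kleisli_comp (binom R K) c0) (c K)) /\
       (forall c1 : channel Y (unit_interval R) R,
          (forall K : nat, channel_eq (kleisli_comp (binom R K) c1) (c K)) ->
          channel_eq c1 c0)).
Proof.
split.
  move=> K r U _; apply: probability_multiset2_eq => k.
  rewrite kleisli_draw_deleteE !binomE.
  rewrite (dd_coneE (binomial_weight_cone (unit_interval_itv r)) (ltn_ord k : k <= K)%N).
  rewrite -!EFinM -EFinD /= /bump/= add1n; congr (_%:E).
  by field; rewrite nat1r.
move=> d Y c cc.
pose nu y K := channel_at (c K) y.
pose p y := multiset2_weight (nu y).
have cp y : dd_cone (p y).
  apply: dd_cone_multiset2_weight => K k.
  by rewrite -kleisli_draw_deleteE cc.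
have mp K k : (k <= K)%N -> measurable_fun setT (fun y => p y K k).
  move=> kK; apply: (@measurableT_comp _ _ _ _ _ _ fine) => //.
  exact: measurable_channel_at.
(* The measure is built separately for each [y]; measurability in [y] reduces to rays, where the
   value is [limit_cdf]. *)
pose c0f (y : Y) : pprobability (unit_interval R) R := limit_measure (cp y).
have mc0 : measurable_fun setT c0f.
  apply: (@measurable_pprobability _ _ _ _ _ (fun y => limit_measure (cp y))).
  apply: measurable_unit_interval_probability => t.
  under eq_fun do rewrite limit_measure_ray.
  by apply/measurable_EFinP; exact: measurable_limit_cdf.
pose c0 : channel Y (unit_interval R) R :=
  HB.pack c0f (isMeasurableFun.Build _ _ _ _ c0f mc0).
have c0at y : channel_at c0 y = limit_measure (cp y) by [].
have c0E K : channel_eq (kleisli_comp (binom R K) c0) (c K).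
  move=> y U _; apply: probability_multiset2_eq => k.
  rewrite kleisli_binomE c0at (binomial_moment_limit (cp y)) -1?ltnS//.
  exact: multiset2_weightE.
exists c0; split => // c1 c1E y U mU.
(* Composed with [binom], both channels give [c], so their measures at [y] share all binomial
   moments. *)
apply: binomial_moment_unique mU => n k kn.
have kE : k = Ordinal (kn : k < n.+1)%N by [].
apply: EFin_inj; rewrite kE -!kleisli_binomE.
by rewrite c1E// c0E.
Qed.
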